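(* Let $\beta>1$ and let $\Gamma$ be a geodesic in the standard chessboard structure from the origin to a light vertex $\xi=(x,y)$ with $0\le y\le x$. Then: (i) if $\beta\ge\beta^c_0$, then $\mathcal{L}_\beta(\Gamma)=x+(\sqrt2-1)y$; (ii) if $\sqrt{3/2}\le\beta\le\beta^c_0$, then \[ \mathcal{L}_\beta(\Gamma)=\begin{cases} x+(\Lambda_3-3)y, & \text{if } 0\le y\le x/3,\\[2pt] \dfrac{\Lambda_3-\sqrt2}{2}\,x+\dfrac{3\sqrt2-\Lambda_3}{2}\,y, & \text{if } x/3\le y\le x.\end{cases} \]
   Context: Standard chessboard structure: for $\beta>1$ let $a_\beta:\mathbb{R}^2\to\{1,\beta\}$ be $2$-periodic in each variable with, on $[0,2)\times[0,2)$, $a_\beta=\beta$ on $((0,1)\times(1,2))\cup((1,2)\times(0,1))$ and $a_\beta=1$ otherwise. The optical length of a curve parametrized by $u\in AC([0,1];\mathbb{R}^2)$ is $\mathcal{L}_\beta(u)=\int_0^1a_\beta(u(t))|u'(t)|\,dt$; a geodesic from $P$ to $Q$ is a curve minimizing $\mathcal{L}_\beta$ among all absolutely continuous curves from $P$ to $Q$. A light vertex is a point $(2n+j,j)$ with $n,j\in\mathbb{Z}$. Normalized length: for $t\ge 0$ let $q(t)=\lfloor t+1\rfloor/2$ if $\lfloor t\rfloor$ is odd and $q(t)=t-\lfloor t\rfloor/2$ if $\lfloor t\rfloor$ is even, $p(t)=t+1-q(t)$; let $\hat\sigma(t,\beta)\in(0,1)$ be the unique solution $\sigma$ of $\frac{p(t)\sigma}{\sqrt{1-\sigma^2}}+\frac{q(t)\sigma}{\sqrt{\beta^2-\sigma^2}}=1$,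 and $l(t,\beta)=\frac{p(t)}{\sqrt{1-\hat\sigma^2}}+\frac{\beta^2q(t)}{\sqrt{\beta^2-\hat\sigma^2}}-t-\sqrt2$. $\beta^c_0$ is the unique $\beta\in(1,\sqrt2)$ with $l(2,\beta)=0$ (existence and uniqueness are shown in the paper). $\Lambda_3=\frac{2}{\sqrt{1-\sigma_3^2}}+\frac{\beta^2}{\sqrt{\beta^2-\sigma_3^2}}$, where $\sigma_3\in(0,1)$ is the unique solution of $\frac{2\sigma}{\sqrt{1-\sigma^2}}+\frac{\sigma}{\sqrt{\beta^2-\sigma^2}}=1$; it is the optical length of an $S_3$-path, i.e. of the minimizing curve joining $(2m+k,k)$ to $(2m+k+3,k+1)$ within the strip $k\le y\le k+1$. *)

(* Defs.v *)
From mathcomp Require Import all_boot all_order all_algebra.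
From mathcomp Require Import all_classical all_reals all_analysis.
Set Implicit Arguments. Unset Strict Implicit. Unset Printing Implicit Defensive.
Import Order.TTheory GRing.Theory Num.Theory.
Local Open Scope classical_set_scope.
Local Open Scope ring_scope.

Section Chessboard.
Variable R : realType.

Definition mod2 (z : R) : R := z - 2 * (Num.floor (z / 2))%:~R.

Definition chess (beta x y : R) : R :=
  if ((0 < mod2 x < 1) && (1 < mod2 y < 2)) ||
     ((1 < mod2 x < 2) && (0 < mod2 y < 1))
  then beta else 1.

Definition abs_cont_on (a b : R) (f : R -> R) : Prop :=
  forall eps : R, 0 < eps -> exists2 delta : R, 0 < delta &
    forall (n : nat) (s t : nat -> R),
      (forall k, (k < n)%N -> a <= s k /\ s k <= t k /\ t k <= b) ->
      (forall k, (k.+1 < n)%N -> t k <= s k.+1) ->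
      \sum_(k < n) (t k - s k) < delta ->
      \sum_(k < n) `|f (t k) - f (s k)| < eps.

Definition AC_curve (u1 u2 : R -> R) : Prop :=
  abs_cont_on 0 1 u1 /\ abs_cont_on 0 1 u2.

Definition optical_length (beta : R) (u1 u2 : R -> R) : \bar R :=
  (\int[@lebesgue_measure R]_(t in `[0%R, 1%R])
     (chess beta (u1 t) (u2 t) *
      Num.sqrt ((derive1 u1 t) ^+ 2 + (derive1 u2 t) ^+ 2))%:E)%E.

Definition geodesic (beta P1 P2 Q1 Q2 : R) (u1 u2 : R -> R) : Prop :=
  [/\ AC_curve u1 u2, (u1 0 = P1 /\ u2 0 = P2), (u1 1 = Q1 /\ u2 1 = Q2) &
   forall v1 v2 : R -> R, AC_curve v1 v2 -> v1 0 = P1 -> v2 0 = P2 ->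
     v1 1 = Q1 -> v2 1 = Q2 ->
     (optical_length beta u1 u2 <= optical_length beta v1 v2)%E].

Definition light_vertex (x y : R) : Prop :=
  exists n j : int, x = (2 * n + j)%:~R /\ y = j%:~R.

Definition qn (t : R) : R :=
  if odd `|Num.floor t|%N then (Num.floor (t + 1))%:~R / 2
  else t - (Num.floor t)%:~R / 2.
Definition pn (t : R) : R := t + 1 - qn t.

Definition sigma_hat (t beta : R) : R :=
  xget 0 [set s : R | 0 < s < 1 /\
    pn t * s / Num.sqrt (1 - s ^+ 2) + qn t * s / Num.sqrt (beta ^+ 2 - s ^+ 2) = 1].

Definition lnorm (t beta : R) : R :=
  pn t / Num.sqrt (1 - sigma_hat t beta ^+ 2)
  + beta ^+ 2 * qn t / Num.sqrt (beta ^+ 2 - sigma_hat t beta ^+ 2)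
  - t - Num.sqrt 2.

(* beta^c_0 : the unique beta in (1, sqrt 2) with l(2,beta) = 0 *)
Definition beta0c : R :=
  xget 0 [set b : R | 1 < b < Num.sqrt 2 /\ lnorm 2 b = 0].

Definition sigma3 (beta : R) : R :=
  xget 0 [set s : R | 0 < s < 1 /\
    2 * s / Num.sqrt (1 - s ^+ 2) + s / Num.sqrt (beta ^+ 2 - s ^+ 2) = 1].

Definition Lambda3 (beta : R) : R :=
  2 / Num.sqrt (1 - sigma3 beta ^+ 2)
  + beta ^+ 2 / Num.sqrt (beta ^+ 2 - sigma3 beta ^+ 2).

End Chessboard.

(* Main.v *)
(** A curve is bounded below by calibration: if [phi] is Lipschitz with the
    constant of the medium in every open square and 1-Lipschitz along the grid
    lines, then the optical length of a curve is at least the increment of [phi]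
    along it.  Both regimes use one potential, equal to [del * x + c * j] on each
    horizontal line [y = j]; it exists as soon as a horizontal step, a diagonal of
    a light square and an S_3-path are not cheaper than the increments [2 * del],
    [del + c] and [3 * del + c] (plus elementary numerical bounds, where
    [beta ^ 2 >= 3 / 2] enters).  Choosing [(del, c)] so that the two cheapest kinds
    of steps are tight, the bound is attained by a polygonal path made of these two
    kinds of steps.  Along an S_3-path the gradient of the potential has vertical
    component [s], the Snell invariant [sigma3], and [Lambda3 = 2 A + B + s] where
    [A = sqrt (1 - s ^ 2)] and [B = sqrt (beta ^ 2 - s ^ 2)]. *)

(* Maxima and minima preserve Lipschitz constants. Inside a square the potential is therefore a
   max-min of affine functions whose gradients do not exceed the medium in norm, and the work lies
   in making the formulas of neighbouring squares agree on the common edges. The number 3/2 is the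
   squared norm of the dark gradient [(del, r)] when [del = 1] and [r = sqrt 2 / 2].

   Competitors are arbitrary absolutely continuous curves, and the potential has no gradient on the
   grid lines. It is therefore differentiated only along the curve, where it is again absolutely
   continuous. At almost every time that the curve spends on a grid line its normal velocity
   vanishes, because transversal crossings are isolated; the bound along the line then suffices.

   [Lambda3] is handled as a minimum over the slopes of three-segment paths. Its monotonicity in
   [beta], and the numerical comparison that forces [beta ^ 2 >= 3 / 2] in the first regime, come
   from inserting particular slopes. *)
Require Import Defs.
From HB Require Import structures.
From mathcomp Require Import all_boot all_order all_algebra.
From mathcomp Require Import all_classical all_reals all_analysis.
From mathcomp Require Import measurable_realfun ring lra zify.
Import Order.TTheory GRing.Theory Num.Theory.
Set Implicit Arguments. Unset Strict Implicit. Unset Printing Implicit Defensive.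
Local Open Scope classical_set_scope.
Local Open Scope ring_scope.

(** * Absolutely continuous functions *)

Section AbsoluteContinuity.
Import numFieldNormedType.Exports.
Variable R : realType.
Implicit Types (f g : R -> R) (d : R -> R -> R).

(* [afam d x L W]: some finite family of successive intervals [s, t] of [0, 1],
   the last one ending at [x], has total length [L] and total weight [W], where
   [[s, t]] weighs [d s t]. *)
Inductive afam d : R -> R -> R -> Prop :=
| afam_nil : afam d 0 0 0
| afam_cons x L W s t : afam d x L W -> x <= s -> s <= t -> t <= 1 ->
    afam d t (L + (t - s)) (W + d s t).

(** The weight is arbitrary, so that majorants and sums of increments can be treated as weights
    themselves. The conclusion is a weak inequality because it has to survive suprema over
    partitions. *)
Definition acf d := forall eps : R, 0 < eps -> exists2 delta : R, 0 < delta &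
  forall x L W, afam d x L W -> L < delta -> W <= eps.

Definition incr f s t := `|f t - f s|.

Lemma afam_ge0 d x L W : afam d x L W -> 0 <= x <= 1 /\ 0 <= L.
Proof.
elim=> [|{}x {}L {}W s t _ [/andP[x0 x1] L0] xs st t1]; first by rewrite lexx ler01.
by rewrite t1 andbT; split; lra.
Qed.

Lemma afam_seq d x L W : afam d x L W -> exists (n : nat) (s t : nat -> R),
  [/\ (forall k, (k < n)%N -> [/\ 0 <= s k, s k <= t k & t k <= x]),
      (forall k, (k.+1 < n)%N -> t k <= s k.+1),
      L = \sum_(k < n) (t k - s k) & W = \sum_(k < n) d (s k) (t k)].
Proof.
elim=> [|{}x {}L {}W s0 t0 fam [n [s [t [H1 H2 LE WE]]]] xs st t1].
  by exists 0%N, (fun=> 0), (fun=> 0); split=> //; rewrite big_ord0.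
have [/andP[x0 _] _] := afam_ge0 fam.
exists n.+1, (fun k => if (k < n)%N then s k else s0),
  (fun k => if (k < n)%N then t k else t0); split.
- move=> k; rewrite ltnS leq_eqVlt; case: ltnP => [kn _|nk _].
    by have [? ? ?] := H1 _ kn; split => //; lra.
  by split => //; lra.
- move=> k; rewrite ltnS => kn; rewrite kn; case: ltnP => [kn'|nk]; first exact: H2.
  by have [_ _] := H1 _ kn; move=> /le_trans; apply.
- rewrite big_ord_recr/= ltnn LE; congr (_ + _).
  by apply: eq_bigr => i _; rewrite ltn_ord.
- rewrite big_ord_recr/= ltnn WE; congr (_ + _).
  by apply: eq_bigr => i _; rewrite ltn_ord.
Qed.

Lemma abs_cont_acf f : abs_cont_on 0 1 f -> acf (incr f).
Proof.
move=> acf eps e0; have [del d0 H] := acf _ e0; exists del => // x L W fam.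
have [/andP[_ x1] _] := afam_ge0 fam.
have [n [s [t [H1 H2 -> ->]]]] := afam_seq fam => Ld.
apply/ltW/H => // k kn; have [? ? ?] := H1 _ kn; split=> //; split=> //; lra.
Qed.

Lemma acf_le d1 d2 (C : R) : 0 < C -> (forall s t, s <= t -> d2 s t <= C * d1 s t) ->
  acf d1 -> acf d2.
Proof.
move=> C0 d12 ac e e0; have [|del del0 H] := ac (e / C); first by rewrite divr_gt0.
exists del => // x L W fam2.
have [W' fam1 WW'] : exists2 W', afam d1 x L W' & W <= C * W'.
  elim: fam2 => [|{}x {}L {}W s t _ [W' fam1 WW'] xs st t1].
    by exists 0; [constructor|rewrite mulr0].
  exists (W' + d1 s t); first by apply: afam_cons fam1 _ _ _.
  by rewrite mulrDr lerD// d12.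
by move=> Ldel; rewrite (le_trans WW')// mulrC -ler_pdivlMr//; exact: H fam1 Ldel.
Qed.

Lemma acfD d1 d2 : acf d1 -> acf d2 -> acf (fun s t => d1 s t + d2 s t).
Proof.
move=> ac1 ac2 e e0; have e20 : 0 < e / 2 by rewrite divr_gt0.
have [d d0 H1] := ac1 _ e20; have [d' d'0 H2] := ac2 _ e20.
exists (Num.min d d'); first by rewrite lt_min d0.
move=> x L W fam.
have [W1 [W2 [fam1 fam2 ->]]] : exists W1 W2, [/\ afam d1 x L W1, afam d2 x L W2 & W = W1 + W2].
  elim: fam => [|{}x {}L {}W s t _ [W1 [W2 [fam1 fam2 ->]]] xs st t1].
    by exists 0, 0; split; [constructor|constructor|rewrite addr0].
  exists (W1 + d1 s t), (W2 + d2 s t); split.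
  - exact: afam_cons fam1 _ _ _.
  - exact: afam_cons fam2 _ _ _.
  - by rewrite addrACA.
by rewrite lt_min => /andP[Ld Ld']; rewrite [e]splitr lerD//; [exact: H1 fam1 Ld|exact: H2 fam2 Ld'].
Qed.

(** The intervals of a partition of [[s, t]] extend the family, adding length [t - s] and weight
    equal to the variation. The new end [x'] may differ from [t]: the empty partition forces [s = t]
    and leaves the family ending at [x]. *)
Lemma afam_partition f (s t x L W : R) (l : seq R) : afam (incr f) x L W -> x <= s -> t <= 1 ->
  itv_partition s t l ->
  exists2 x', x' <= t & afam (incr f) x' (L + (t - s)) (W + variation s t f l).
Proof.
elim: l s x L W => [|a l ih] s x L W fam xs t1 sl.
  move: xs; rewrite (itv_partition_nil sl) => xt.
  by exists x; rewrite // subrr variation_nil !addr0.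
have al := itv_partition_cons sl.
have at_ : a <= t := itv_partition_le al.
have sa : s < a by have [] := sl; rewrite /= => /andP[].
have -> : variation s t f (a :: l) = incr f s a + variation a t f l :> R.
  by rewrite /variation big_nat_recl.
have fam' := afam_cons fam xs (ltW sa) (le_trans at_ t1).
have [x' x't H] := ih a a _ _ fam' (lexx _) t1 al.
exists x' => //; rewrite [W + _]addrA.
by have -> : L + (t - s) = L + (a - s) + (t - a) by lra.
Qed.


Local Notation TV := total_variation.

Lemma acf_TV_small f (eps : R) : acf (incr f) -> 0 < eps -> exists2 del : R, 0 < del &
  forall s t, 0 <= s -> s <= t -> t <= 1 -> t - s < del -> (TV s t f <= eps%:E)%E.
Proof.
move=> ac e0; have [del d0 H] := ac _ e0; exists del => // s t s0 st t1 td.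
apply: ge_ereal_sup => y [r [l sl <-] <-]; rewrite lee_fin.
have [x' _] := afam_partition (afam_nil (incr f)) s0 t1 sl.
by rewrite !add0r => fam; exact: H fam td.
Qed.

(** The unit interval is cut into [N.+1] pieces, each so short that the variation on it is at most
    1. *)
Lemma acf_BV f : acf (incr f) -> bounded_variation 0 1 f.
Proof.
move=> ac; have [del d0 H] := acf_TV_small ac ltr01.
have [N Nd] : exists N : nat, N.+1%:R^-1 < del.
  by have [N _ /(_ N (leqnn _))] := near_infty_natSinv_lt (PosNum d0); exists N.
have N0 : 0 < N.+1%:R :> R by [].
have K m : (m <= N.+1)%N -> (TV 0 (m%:R / N.+1%:R) f <= m%:R%:E)%E.
  elim: m => [|m ih] mN; first by rewrite mul0r total_variationxx.
  rewrite (@total_variationD _ _ _ (m%:R / N.+1%:R)); last 2 first.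
  - by rewrite divr_ge0.
  - by rewrite ler_pM2r ?invr_gt0// ler_nat.
  rewrite -[in leRHS]natr1 EFinD leeD ?ih ?(ltnW mN)//; apply: H.
  - by rewrite divr_ge0.
  - by rewrite ler_pM2r ?invr_gt0// ler_nat.
  - by rewrite ler_pdivrMr// mul1r ler_nat.
  - by rewrite -mulrBl -natr1 addrAC subrr add0r mul1r.
apply/bounded_variationP => //; rewrite ge0_fin_numE ?total_variation_ge0//.
by have := K _ (leqnn _); rewrite divff ?gt_eqF// => /le_lt_trans; apply; rewrite ltry.
Qed.

Definition tvf f x : R := fine (TV 0 x f).

Lemma tvfE f x : bounded_variation 0 1 f -> 0 <= x <= 1 -> (tvf f x)%:E = TV 0 x f.
Proof.
move=> bv /andP[x0 x1]; rewrite fineK//; apply/bounded_variationP => //.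
exact: bounded_variationl bv.
Qed.

Lemma tvfB f s t : bounded_variation 0 1 f -> 0 <= s -> s <= t -> t <= 1 ->
  TV s t f = (tvf f t - tvf f s)%:E.
Proof.
move=> bv s0 st t1; rewrite EFinB !tvfE ?s0 ?t1 ?(le_trans s0 st) ?(le_trans st t1)//.
have sE := @tvfE f s bv _.
rewrite (total_variationD f s0 st) -sE ?s0 ?(le_trans st t1)//.
by rewrite addeAC subee// add0e.
Qed.

Lemma incr_tvf f s t : bounded_variation 0 1 f -> 0 <= s -> s <= t -> t <= 1 ->
  incr f s t <= tvf f t - tvf f s.
Proof.
by move=> bv s0 st t1; rewrite -lee_fin -tvfB//; exact: total_variation_ge.
Qed.

(** Every interval of a family is refined by a partition that almost attains its total variation.
    Refinement keeps the total length, so the [delta] of [f] serves again. The error [eta] is split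
    in two at each interval, one half for it and one half for all earlier ones. *)
Lemma acf_tvf f : acf (incr f) -> acf (incr (tvf f)).
Proof.
move=> ac e e0; have bv := acf_BV ac.
have [del d0 H] := ac _ e0; exists del => // x L W fam Ld.
suff K eta : 0 < eta -> exists x' W', [/\ x' <= x, afam (incr f) x' L W' & W <= W' + eta].
  apply/ler_addgt0Pr => eta /K[x' [W' [_ fam' WW']]].
  by rewrite (le_trans WW')// lerD2r; exact: H fam' Ld.
clear Ld; elim: fam eta => [|{}x {}L {}W s t fam ih xs st t1] eta eta0.
  by exists 0, 0; split; [|constructor|rewrite add0r ltW].
have [|x' [W' [x'x fam' WW']]] := ih (eta / 2); first by rewrite divr_gt0.
have [/andP[x0 _] _] := afam_ge0 fam; have s0 := le_trans x0 xs.
have /ereal_sup_gt : ((incr (tvf f) s t - eta / 2)%:E < TV s t f)%E.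
  rewrite tvfB// lte_fin /incr ger0_norm; first lra.
  exact: le_trans (normr_ge0 _) (incr_tvf bv s0 st t1).
move=> [_ [_ [l sl <-] <-]]; rewrite lte_fin => ll.
have [x'' x''t fam''] := afam_partition fam' (le_trans x'x xs) t1 sl.
by exists x'', (W' + variation s t f l); split => //; lra.
Qed.

Lemma acf_jordan f : acf (incr f) -> exists g1 g2 : R -> R,
  [/\ acf (incr g1), acf (incr g2), {in `[0, 1] &, {homo g1 : x y / x <= y}},
      {in `[0, 1] &, {homo g2 : x y / x <= y}} & f = g1 \- g2].
Proof.
move=> ac; have bv := acf_BV ac; have acT := acf_tvf ac.
have nd s t : s \in `[0, 1] -> t \in `[0, 1] -> s <= t -> `|f t - f s| <= tvf f t - tvf f s.
  rewrite !in_itv/= => /andP[s0 _] /andP[_ t1] st; exact: incr_tvf.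
exists (tvf f), (tvf f \- f); split=> //.
- apply: acf_le ltr01 _ (acfD acT ac) => s t st; rewrite mul1r /incr/=.
  have -> : tvf f t - f t - (tvf f s - f s) = (tvf f t - tvf f s) - (f t - f s) by lra.
  exact: ler_normB.
- by move=> s t s0 t1 st; rewrite -subr_ge0 (le_trans _ (nd _ _ s0 t1 st)).
- move=> s t s0 t1 st /=; have H1 := ler_norm (f t - f s); have H2 := nd _ _ s0 t1 st; lra.
- by apply/funext => x /=; lra.
Qed.

End AbsoluteContinuity.

(** * Densities of absolutely continuous functions *)

Section Density.
Import numFieldNormedType.Exports.
Variable R : realType.
Notation mu := (@lebesgue_measure R).

Lemma nat_ceil (y : R) : 0 < y -> exists k : nat, k%:R < y <= k.+1%:R.
Proof.
move=> y0; have ex : exists n : nat, y <= n%:R.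
  by exists (Num.bound y); rewrite ltW// archi_boundP// ltW.
case: (ex_minnP ex) => -[|k] yk kmin; first by move: yk; rewrite leNgt y0.
by exists k; rewrite yk andbT ltNge; apply/negP => /kmin; rewrite ltnn.
Qed.

(** Left-open intervals, so that neighbours are disjoint and the Stieltjes measure of each is
    exactly an increment. *)
Definition dyad (n k : nat) : set R := `]k%:R / 2 ^+ n, k.+1%:R / 2 ^+ n].

(** The cut-off [m] allows induction one interval at a time; [m = 2 ^ n] reaches the end of the unit
    interval. *)
Definition dyads (U : set R) (n m : nat) : set R :=
  \bigcup_(k in [set k | (k < m)%N /\ dyad n k `<=` U]) dyad n k.

Lemma pow2_gt0 n : 0 < 2 ^+ n :> R. Proof. by rewrite exprn_gt0. Qed.

Lemma dyadP n k (x : R) : dyad n k x <-> k%:R < 2 ^+ n * x <= k.+1%:R.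
Proof.
by rewrite /dyad/= in_itv/= ltr_pdivrMr ?pow2_gt0// ler_pdivlMr ?pow2_gt0// [x * _]mulrC.
Qed.

Lemma dyads_nd U : nondecreasing_seq (fun n => dyads U n (2 ^ n)).
Proof.
apply/nondecreasing_seqP => n; apply/subsetPset => x [k [kn kU] /[dup] kx /dyadP].
move=> /andP[kx1 kx2].
have [kx3|kx3] := leP (2 ^+ n.+1 * x) (k.*2.+1)%:R.
  exists k.*2.
    split; first by rewrite expnS mul2n ltn_double.
    move=> y yk; apply: kU; apply/dyadP; move: yk => /dyadP.
    rewrite exprS -!natr1 -muln2 natrM => /andP[y1 y2]; apply/andP; split; lra.
  apply/dyadP; rewrite kx3 andbT exprS -muln2 natrM -mulrA; lra.
exists k.*2.+1.
  split; first by rewrite expnS mul2n -doubleS leq_double.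
  move=> y yk; apply: kU; apply/dyadP; move: yk => /dyadP.
  rewrite exprS -!natr1 -muln2 natrM => /andP[y1 y2]; apply/andP; split; lra.
apply/dyadP; rewrite kx3/=; move: kx2; rewrite exprS -!natr1 -muln2 natrM; lra.
Qed.

Lemma open_dyads (U : set R) : open U -> U `&` `]0, 1] `<=` \bigcup_n dyads U n (2 ^ n).
Proof.
move=> oU x [Ux]; rewrite /= in_itv/= => /andP[x0 x1].
have /nbhs_ballP[r /= r0 xr] : nbhs x U by apply: open_nbhs_nbhs.
have [n nr] : exists n, (2 ^+ n)^-1 < r.
  have [n _ /(_ n (leqnn _))] := near_infty_natSinv_lt (PosNum r0) => /= nr; exists n.
  rewrite (le_lt_trans _ nr)// lef_pV2 ?posrE ?pow2_gt0// -natrX ler_nat.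
  exact: ltn_expl.
have [|k /andP[k1 k2]] := @nat_ceil (2 ^+ n * x); first by rewrite mulr_gt0 ?pow2_gt0.
exists n => //; exists k; last by apply/dyadP; rewrite k1.
split.
  rewrite -(ltr_nat R) natrX (lt_le_trans k1)// -[leRHS]mulr1 ler_pM2l ?pow2_gt0//.
move=> y /dyadP /andP[y1 y2]; apply: xr; rewrite /ball/= (le_lt_trans _ nr)//.
rewrite -[leRHS]mul1r ler_pdivlMr ?pow2_gt0// mulrC -[X in X * _]gtr0_norm ?pow2_gt0//.
by rewrite -normrM mulrBr ler_norml; move: k2 y2; rewrite -natr1 => k2 y2; apply/andP; split; lra.
Qed.

Lemma stieltjes_oc (F : cumulative R R) (a b : R) : a <= b ->
  lebesgue_stieltjes_measure F `]a, b] = (F b - F a)%:E.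
Proof.
move=> ab; rewrite /lebesgue_stieltjes_measure/= /measure_extension/=.
by rewrite measurable_mu_extE//=; [rewrite wlength_itv_bnd|exact: is_ocitv].
Qed.

Lemma lebesgue_oc (a b : R) : a <= b -> mu `]a, b] = (b - a)%:E.
Proof. by move=> ab; rewrite /lebesgue_measure stieltjes_oc. Qed.

Lemma dyads_afam (F : cumulative R R) U n m : (m <= 2 ^ n)%N ->
  exists x L W, [/\ afam (incr F) x L W, x <= m%:R / 2 ^+ n,
    mu (dyads U n m) = L%:E & lebesgue_stieltjes_measure F (dyads U n m) = W%:E].
Proof.
have mV k : measurable (dyads U n k) by apply: bigcup_measurable => i _; exact: measurable_itv.
elim: m => [|m ih] mn.
  exists 0, 0, 0; rewrite mul0r.
  have -> : dyads U n 0 = set0 by rewrite /dyads -subset0 => x [k []].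
  by split; rewrite ?measure0//; constructor.
have [x [L [W [fam xm LE WE]]]] := ih (ltnW mn).
have mm1 : m%:R / 2 ^+ n <= m.+1%:R / 2 ^+ n :> R by rewrite ler_pM2r ?invr_gt0 ?pow2_gt0// ler_nat.
have [mU|mU] := pselect (dyad n m `<=` U); last first.
  exists x, L, W; split=> //; first exact: le_trans mm1.
    by rewrite -LE; congr (mu _); apply/seteqP; split=> y [k [km kU] ky]; exists k => //; split=> //;
      [move: km; rewrite ltnS leq_eqVlt => /orP[/eqP kE|//]; rewrite kE in kU|exact: ltnW].
  by rewrite -WE; congr (lebesgue_stieltjes_measure F _); apply/seteqP; split=> y [k [km kU] ky]; exists k => //; split=> //;
      [move: km; rewrite ltnS leq_eqVlt => /orP[/eqP kE|//]; rewrite kE in kU|exact: ltnW].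
have VE : dyads U n m.+1 = dyads U n m `|` dyad n m.
  apply/seteqP; split=> [y [k [km kU] ky]|y [[k [km kU] ky]|ym]].
  - move: km; rewrite ltnS leq_eqVlt => /orP[/eqP <-|km]; first by right.
    by left; exists k.
  - by exists k => //; split=> //; exact: ltnW.
  - by exists m.
have dis : dyads U n m `&` dyad n m = set0.
  rewrite -subset0 => y [[k [km _] /dyadP/andP[_ ky]] /dyadP/andP[my _]].
  by have := lt_le_trans my ky; rewrite ltr_nat ltnNge km.
have mI : measurable (dyad n m) by exact: measurable_itv.
exists (m.+1%:R / 2 ^+ n), (L + (m.+1%:R / 2 ^+ n - m%:R / 2 ^+ n)),
  (W + incr F (m%:R / 2 ^+ n) (m.+1%:R / 2 ^+ n)); split.
- by apply: afam_cons fam xm mm1 _; rewrite ler_pdivrMr ?pow2_gt0// mul1r -natrX ler_nat.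
- by [].
- rewrite VE EFinD -LE -(lebesgue_oc mm1); by apply: (@measureU _ _ _ mu) => //; exact: mV.
- rewrite VE /incr ger0_norm; last by rewrite subr_ge0 cumulative_is_nondecreasing.
  rewrite EFinD -WE -(stieltjes_oc F mm1).
  by apply: (@measureU _ _ _ (lebesgue_stieltjes_measure F)) => //; exact: mV.
Qed.

(** Outer regularity puts [N] in an open [U] of measure below [delta]. The dyadic intervals of one
    level inside [U] form a finite family of total length below [delta], hence of Stieltjes measure
    at most [e]; as the level grows they exhaust the part of [U] in []0, 1]]. *)
Lemma acf_dominates (F : cumulative R R) (N : set R) : acf (incr F) ->
  measurable N -> mu N = 0%E ->
  lebesgue_stieltjes_measure F (N `&` `]0, 1]) = 0%E.
Proof.
move=> ac mN N0; set nu := lebesgue_stieltjes_measure F.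
have m01 : measurable (`]0, 1] : set R) by exact: measurable_itv.
apply/eqP; rewrite eq_le measure_ge0 andbT; apply/lee_addgt0Pr => e e0; rewrite add0e.
have [del d0 H] := ac _ e0.
have [U [oU NU Udel]] : exists U : set R, [/\ open U, N `<=` U & (mu (U `\` N) < del%:E)%E].
  have Nfin : (mu N < +oo)%E by rewrite N0 ltry.
  exact: lebesgue_regularity_outer.
have mU : measurable U by exact: open_measurable.
have {}Udel : (mu U < del%:E)%E.
  rewrite -(setDKU NU); apply: le_lt_trans Udel.
  apply: (@le_trans _ _ (mu (U `\` N) + mu N)%E); last by rewrite N0 adde0.
  by apply: (@measureU2 _ _ _ mu) => //; exact: measurableD.
have mV n k : measurable (dyads U n k) by apply: bigcup_measurable => i _; exact: measurable_itv.
have mV' : measurable (\bigcup_n dyads U n (2 ^ n)) by exact: bigcup_measurable.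
apply: (@le_trans _ _ (nu (\bigcup_n dyads U n (2 ^ n)))).
  apply: le_measure; rewrite ?inE//; first exact: measurableI.
  by apply: subset_trans (open_dyads oU); exact: setSI.
have cv := nondecreasing_cvg_mu (mu := nu) (fun n => mV n (2 ^ n)%N) mV' (@dyads_nd U).
have E : limn (fun n => nu (dyads U n (2 ^ n))) = nu (\bigcup_n dyads U n (2 ^ n)).
  exact: cvg_lim cv.
rewrite -E; apply: lime_le; first exact: cvgP cv.
apply: nearW => n /=.
have [x [L [W [fam _ LE NE]]]] := dyads_afam F U (leqnn (2 ^ n)).
apply: (@le_trans _ _ W%:E); first by rewrite -NE.
rewrite lee_fin; apply: H fam _; rewrite -lte_fin -LE; apply: le_lt_trans Udel.
apply: le_measure; rewrite ?inE//; first exact: mV.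
by move=> y [k [_ kU] /kU].
Qed.

Let clamp (x : R) : R := Num.max 0 (Num.min 1 x).

Lemma clampP x : 0 <= clamp x <= 1.
Proof. by rewrite /clamp le_max lexx/= ge_max ler01 ge_min lexx. Qed.

Lemma clamp_id x : 0 <= x <= 1 -> clamp x = x.
Proof. by move=> /andP[x0 x1]; rewrite /clamp min_r// max_r. Qed.

Lemma clamp_le x y : x <= y -> clamp x <= clamp y.
Proof. move=> xy; rewrite /clamp.
have [?|?] := leP 1 x; have [?|?] := leP 1 y; have [?|?] := leP 0 x;
  have [?|?] := leP 0 y; have [?|?] := leP (0 : R) 1; lra. Qed.

Lemma clampB x y : x <= y -> clamp y - clamp x <= y - x.
Proof. move=> xy; rewrite /clamp.
have [?|?] := leP 1 x; have [?|?] := leP 1 y; have [?|?] := leP 0 x;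
  have [?|?] := leP 0 y; have [?|?] := leP (0 : R) 1; lra. Qed.

(** The density is the Radon-Nikodym derivative of the Stieltjes measure of [g]. Composing with
    [clamp] extends [g] by constants, because a cumulative function must be monotone on the whole
    line. *)
Lemma acf_density_mono (g : R -> R) : acf (incr g) ->
  {in `[0, 1] &, {homo g : x y / x <= y}} ->
  exists h : R -> R, mu.-integrable setT (EFin \o h) /\
    forall x, 0 <= x <= 1 -> g x - g 0 = (\int[mu]_(t in `]0%R, x]) h t)%R.
Proof.
move=> ac nd; pose G := g \o clamp.
have Gnd : nondecreasing G.
  by move=> x y xy; apply: nd; rewrite ?in_itv/= ?clampP// clamp_le.
have Grc : right_continuous G.
  move=> x; apply/cvgrPdist_le => e e0; have [del d0 H] := ac _ e0.
  near=> y; have xy : x <= y by near: y; exact: nbhs_right_ge.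
  have yd : y < x + del by near: y; apply: nbhs_right_lt; rewrite ltrDl.
  have /andP[cx0 cx1] := clampP x; have /andP[cy0 cy1] := clampP y.
  have := afam_cons (afam_nil (incr g)) cx0 (clamp_le xy) cy1.
  rewrite !add0r distrC /G/= => /H; apply.
  by rewrite (le_lt_trans (clampB xy))// ltrBlDl.
pose F : cumulative R R := HB.pack G (isCumulative.Build R _ R G Gnd Grc).
have acF : acf (incr F).
  move=> e e0; have [del d0 H] := ac _ e0; exists del => // x L W fam Ld.
  apply: (H x L W _ Ld); clear Ld; elim: fam => [|{}x {}L {}W s t fam ih xs st t1].
    by constructor.
  have -> : incr F s t = incr g s t.
    have [/andP[x0 _] _] := afam_ge0 fam.
    rewrite /incr /F/= /G/= !clamp_id// ?t1 ?(le_trans st)// ?andbT; lra.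
  exact: afam_cons ih _ _ _.
have m01 : @measurable _ (measurableTypeR R) `]0, 1]%classic by exact: measurable_itv.
pose nu0 : {measure set (measurableTypeR R) -> \bar R} := lebesgue_stieltjes_measure F.
have nuE (a b : R) : a <= b -> nu0 `]a, b]%classic = (G b - G a)%:E by exact: stieltjes_oc.
have fin : (nu0 `]0%R, 1%R]%classic < +oo)%E by rewrite nuE// ltry.
pose nu : {finite_measure set (measurableTypeR R) -> \bar R} := mfrestr m01 fin.
have dom : nu `<< mu.
  by apply/null_content_dominatesP => A mA A0; exact: acf_dominates.
have [h [h0 hfin hint hE]] := radon_nikodym_sigma_finite dom.
exists (fine \o h); split.
  by apply: eq_integrable hint => // x _ /=; rewrite fineK.
move=> x /andP[x0 x1]; rewrite /Rintegral.
have -> : (\int[mu]_(t in `]0%R, x]) ((fine \o h) t)%:E = nu `]0%R, x]%classic)%E.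
  rewrite hE; last exact: measurable_itv.
  by apply: eq_integral => t _ /=; rewrite fineK.
have -> : nu `]0%R, x]%classic = nu0 `]0%R, x]%classic.
  rewrite /nu/= /mfrestr /mrestr setIidl// => t /=; rewrite !in_itv/= => /andP[-> tx]/=.
  exact: le_trans x1.
by rewrite nuE//= /G/= !clamp_id ?lexx ?ler01 ?x0.
Unshelve. all: by end_near. Qed.

Lemma acf_density (f : R -> R) : acf (incr f) ->
  exists h : R -> R, mu.-integrable setT (EFin \o h) /\
    forall x, 0 <= x <= 1 -> f x - f 0 = (\int[mu]_(t in `]0%R, x]) h t)%R.
Proof.
move=> /acf_jordan[g1 [g2 [ac1 ac2 nd1 nd2 ->]]].
have [h1 [i1 E1]] := acf_density_mono ac1 nd1.
have [h2 [i2 E2]] := acf_density_mono ac2 nd2.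
exists (h1 \- h2); split.
  by apply: eq_integrable (integrableB measurableT i1 i2) => // x _ /=.
move=> x x01 /=; rewrite RintegralB//.
- by rewrite -E1// -E2//; lra.
- by apply: (integrableS measurableT) => //; exact: measurable_itv.
- by apply: (integrableS measurableT) => //; exact: measurable_itv.
Qed.

(** Lebesgue differentiation identifies the density with the derivative almost everywhere. The
    integral formula holds on [[0, 1]] only, hence the restriction to interior points, around which
    [f] and the primitive differ by the constant [f 0]. *)
Lemma acf_derive (f : R -> R) : acf (incr f) ->
  exists h : R -> R, [/\ mu.-integrable setT (EFin \o h),
    f 1 - f 0 = (\int[mu]_(t in `]0%R, 1%R]) h t)%R &
    {ae mu, forall x : R, 0 < x < 1 -> is_derive x 1 f (h x)}].
Proof.
move=> /acf_density[h [hint hE]]; exists h; split=> //; first by rewrite hE// ler01 lexx.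
have hint' y : mu.-integrable `]0%R, y] (EFin \o h).
  by apply: (integrableS measurableT) => //; exact: measurable_itv.
have := @FTC1 R h (BRight 0) hint' (open_integrable_locally openT hint).
apply: filterS; first exact: (ae_filter_ringOfSetsType mu).
move=> x /= H /andP[x0 x1].
have [|dF FE] := H; first by rewrite lte_fin.
set F := fun y => _ in dF FE.
have {}FE : is_derive x 1 F (h x).
  by apply: DeriveDef => //; rewrite -derive1E FE.
have fF : \near x, f x = F x + f 0.
  near=> y; apply/eqP; rewrite -subr_eq; apply/eqP; apply: hE.
  apply/andP; split; apply: ltW; near: y.
    exact: lt_nbhsr.
  exact: lt_nbhsl.
apply: (@near_eq_is_derive _ _ _ (fun y => F y + f 0)).
  by apply: filterS fF => y ->.
by rewrite -[h x]addr0; apply: is_deriveD.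
Unshelve. all: by end_near. Qed.

End Density.

(** * Calibrations bound optical lengths from below *)

Section LowerBound.
Import numFieldNormedType.Exports.
Variable R : realType.
Notation mu := (@lebesgue_measure R).
Implicit Types (u : R -> R) (beta t x y : R).

Lemma mod2E (m : int) x : (2 * m)%:~R <= x -> x < (2 * m + 2)%:~R ->
  mod2 x = x - (2 * m)%:~R.
Proof.
move=> x1 x2; rewrite /mod2 (_ : Num.floor _ = m) ?intrM//.
apply: floor_def; move: x1 x2; rewrite !intrD !intrM.
by move=> x1 x2; apply/andP; split; lra.
Qed.

Lemma int_parity (k : int) : exists m : int, k = 2 * m \/ k = 2 * m + 1.
Proof.
exists (k %/ 2)%Z; have kE := divz_eq k 2.
have k2 : (k %% 2 < 2)%Z by exact: ltz_pmod.
have k0 : 0 <= (k %% 2)%Z by exact: modz_ge0.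
lia.
Qed.

Lemma chess_ge1 beta x y : 1 <= beta -> 1 <= chess beta x y.
Proof. by move=> b1; rewrite /chess; case: ifP. Qed.

Lemma chess_light beta x y (k j m : int) : k = j + 2 * m ->
  k%:~R < x < (k + 1)%:~R -> j%:~R < y < (j + 1)%:~R -> chess beta x y = 1.
Proof.
move=> -> /andP[x1 x2] /andP[y1 y2].
have [n [jE|jE]] := int_parity j; subst j; rewrite /chess;
  move: x1 x2 y1 y2; rewrite !intrD !intrM => x1 x2 y1 y2.
- rewrite (@mod2E (n + m)) ?(@mod2E n) ?intrD ?intrM ?intrD; [|lra..].
  by rewrite ifF//; apply/negbTE/negP => /orP[] /andP[/andP[? ?] /andP[? ?]]; lra.
- rewrite (@mod2E (n + m)) ?(@mod2E n) ?intrD ?intrM ?intrD; [|lra..].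
  by rewrite ifF//; apply/negbTE/negP => /orP[] /andP[/andP[? ?] /andP[? ?]]; lra.
Qed.

Lemma chess_dark beta x y (k j m : int) : k = j + 2 * m + 1 ->
  k%:~R < x < (k + 1)%:~R -> j%:~R < y < (j + 1)%:~R -> chess beta x y = beta.
Proof.
move=> -> /andP[x1 x2] /andP[y1 y2].
have [n [jE|jE]] := int_parity j; subst j; rewrite /chess;
  move: x1 x2 y1 y2; rewrite !intrD !intrM => x1 x2 y1 y2.
- rewrite (@mod2E (n + m)) ?(@mod2E n) ?intrD ?intrM ?intrD; [|lra..].
  rewrite ifT//; apply/orP; right; apply/andP; split; apply/andP; split; lra.
- rewrite (@mod2E (n + m + 1)) ?(@mod2E n) ?intrD ?intrM ?intrD; [|lra..].
  rewrite ifT//; apply/orP; left; apply/andP; split; apply/andP; split; lra.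
Qed.

Lemma chess_horizontal beta x (j : int) : chess beta x j%:~R = 1.
Proof.
have [n [->|->]] := int_parity j; rewrite /chess.
- rewrite (@mod2E n (2 * n)%:~R) ?ltr_int ?ltrDl// subrr.
  by rewrite ifF//; apply/negbTE/negP => /orP[] /andP[/andP[? ?] /andP[? ?]]; lra.
- rewrite (@mod2E n (2 * n + 1)%:~R) ?ltr_int ?ler_int ?lerDl ?ltrD2l// intrD addrAC subrr.
  by rewrite ifF//; apply/negbTE/negP => /orP[] /andP[/andP[? ?] /andP[? ?]]; lra.
Qed.

Lemma is_derive_quotient (g : R -> R) t (l : R) : is_derive t 1 g l ->
  (fun h => h^-1 * (g (h + t) - g t)) @ 0^' --> l.
Proof.
move=> [dg <-]; rewrite /derive; have := dg; rewrite /derivable.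
set q := (X in cvg (X @ _)) => cq.
have -> : (fun h => h^-1 * (g (h + t) - g t)) = q.
  by apply/funext => h; rewrite /q /= [h *: 1]mulr1.
exact: cq.
Qed.

(** One estimate for all positions of the curve: inside a square only the term in [K] is present,
    while on a grid line one of [C1], [C2] is 1 and the other multiplies a derivative that
    vanishes. *)
Lemma derive_le (F u1 u2 : R -> R) t (f a b K C1 C2 : R) :
  is_derive t 1 F f -> is_derive t 1 u1 a -> is_derive t 1 u2 b ->
  (\forall s \near t, `|F s - F t| <= K * Num.sqrt ((u1 s - u1 t) ^+ 2 + (u2 s - u2 t) ^+ 2)
     + C1 * `|u1 s - u1 t| + C2 * `|u2 s - u2 t|) ->
  `|f| <= K * Num.sqrt (a ^+ 2 + b ^+ 2) + C1 * `|a| + C2 * `|b|.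
Proof.
move=> dF d1 d2 H.
have {}H : \forall h \near (0 : R)^', `|h^-1 * (F (h + t) - F t)| <=
   K * Num.sqrt ((h^-1 * (u1 (h + t) - u1 t)) ^+ 2 + (h^-1 * (u2 (h + t) - u2 t)) ^+ 2)
     + C1 * `|h^-1 * (u1 (h + t) - u1 t)| + C2 * `|h^-1 * (u2 (h + t) - u2 t)|.
  have [r /= r0 Hr] := (iffLR (nbhs_ballP _ _) H).
  near=> h.
  have h0 : h != 0 by near: h; exact: nbhs_dnbhs_neq.
  have hr : `|h| < r by near: h; exact: dnbhs0_lt.
  have /Hr : ball t r (h + t) by rewrite /ball/= opprD addrCA subrr addr0 normrN.
  have q0 : 0 < `|h^-1| by rewrite normr_gt0 invr_neq0.
  rewrite -(ler_pM2l q0) -normrM => /le_trans; apply.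
  rewrite !exprMn -mulrDr sqrtrM ?sqr_ge0// sqrtr_sqr !normrM.
  by rewrite le_eqVlt; apply/orP; left; apply/eqP; ring.
have csq (g : R -> R) (l : R) : g @ 0^' --> l -> (fun h => g h ^+ 2) @ 0^' --> l ^+ 2.
  by move=> gl; apply: (cvgM gl gl).
apply: (ler_cvg_to _ _ H); first exact: cvg_norm (is_derive_quotient dF).
have c1 := is_derive_quotient d1; have c2 := is_derive_quotient d2.
apply: cvgD; first apply: cvgD.
- apply: cvgM; first exact: cvg_cst.
  apply: continuous_cvg; first exact: sqrt_continuous.
  by apply: cvgD; exact: csq.
- by apply: cvgM; [exact: cvg_cst|exact: cvg_norm].
- by apply: cvgM; [exact: cvg_cst|exact: cvg_norm].
Unshelve. all: by end_near. Qed.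


(** The integral of a nonnegative function is a supremum over the simple functions below it, so a
    pointwise comparison is enough. This makes it applicable to the optical integrand of an
    arbitrary curve. *)
Lemma ge0_le_integral_nonmeasurable (D E : set R) (f g : R -> \bar R) : D `<=` E ->
  (forall x, D x -> 0 <= f x)%E -> (forall x, E x -> 0 <= g x)%E ->
  (forall x, D x -> f x <= g x)%E ->
  (\int[mu]_(x in D) f x <= \int[mu]_(x in E) g x)%E.
Proof.
move=> DE f0 g0 fg; rewrite !ge0_integralE//; apply: ereal_sup_le.
move=> _ [h /= hf <-]; exists h => //= x; apply: le_trans (hf x) _.
rewrite /patch; case: ifPn => [|_].
  by rewrite inE => Dx; rewrite mem_set; [exact: fg|exact: DE].
by case: ifPn => //; rewrite inE => /g0.
Qed.

(** A nonzero derivative makes [t] isolated in its level set, say within distance [1 / n.+1]. The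
    level, the number [n] and the index of the interval of length [1 / n.+1] containing [t] then
    determine [t]. *)
Lemma countable_crossing u : countable [set t : R | exists (k : int) (h : R),
  [/\ 0 < t, is_derive t 1 u h, h != 0 & u t = k%:~R]].
Proof.
set A := [set t | _].
have /choice[p pP] : forall t : R, exists p : int * nat * nat, A t -> [/\ u t = p.1.1%:~R,
    forall s, 0 < `|s - t| < p.1.2.+1%:R^-1 -> u s != u t &
    p.2%:R < p.1.2.+1%:R * t <= p.2.+1%:R].
  move=> t.
  have [At|nAt] := pselect (A t); last by exists (0, 0%N, 0%N).
  have [k [h [t0 du h0 utk]]] := At.
  have [r /= r0 Hr] : \forall h \near (0 : R), h != 0 -> u (h + t) != u t.
    have : \forall q \near (0 : R)^', q^-1 * (u (q + t) - u t) != 0.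
      by apply: cvgr_neq0 h0; exact: is_derive_quotient.
    rewrite near_withinE.
    by apply: filterS => q /[apply]; apply: contra_neq => ->; rewrite subrr mulr0.
  have [n _ /(_ n (leqnn _))] := near_infty_natSinv_lt (PosNum r0) => /= nr.
  have [|c cP] := @nat_ceil R (n.+1%:R * t); first by rewrite mulr_gt0.
  exists (k, n, c) => _ /=; split=> // s /andP[s0 sn].
  have := Hr (s - t); rewrite subrK; apply; last by rewrite -normr_gt0.
  by rewrite /ball/= sub0r normrN (lt_trans sn).
apply/countable_injP; exists (fun t => pickle (p t)).
move=> s t; rewrite !inE => As At /(pcan_inj pickleK) pst.
have [us Hs cs] := pP _ As; have [ut Ht ct] := pP _ At; rewrite -pst in ut Ht ct.
apply: contrapT => /eqP st.
have /negP[] : u s != u t; last by rewrite us ut.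
apply: Ht; rewrite normr_gt0 subr_eq0 st/= -[ltRHS]mul1r ltr_pdivlMr// mulrC.
rewrite -[X in X * _]gtr0_norm// -normrM mulrBr ltr_norml.
move: cs ct; rewrite -[X in _ <= X]natr1 => /andP[? ?] /andP[? ?].
by apply/andP; split; lra.
Qed.

Lemma null_crossing u : {ae mu, forall t (k : int) (h : R),
  0 < t -> is_derive t 1 u h -> u t = k%:~R -> h = 0}.
Proof.
have cA := countable_crossing u; set A := [set t | _] in cA.
exists A; split; first exact: countable_measurable.
  exact: countable_lebesgue_measure0.
move=> t /= /existsNP[k /existsNP[h /not_implyP[t0 /not_implyP[du /not_implyP[utk /eqP h0]]]]].
by exists k, h.
Qed.

Record calibration beta (phi : R -> R -> R) : Prop := Calibration {
  calib_lip : exists2 C, 0 <= C & forall x y x' y',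
    `|phi x y - phi x' y'| <= C * (`|x - x'| + `|y - y'|);
  calib_hor : forall (j : int) x x', `|phi x j%:~R - phi x' j%:~R| <= `|x - x'|;
  calib_ver : forall (k : int) y y', `|phi k%:~R y - phi k%:~R y'| <= `|y - y'|;
  calib_light : forall (k j m : int) x y x' y', k = j + 2 * m ->
    k%:~R < x < (k + 1)%:~R -> j%:~R < y < (j + 1)%:~R ->
    k%:~R < x' < (k + 1)%:~R -> j%:~R < y' < (j + 1)%:~R ->
    `|phi x y - phi x' y'| <= Num.sqrt ((x - x') ^+ 2 + (y - y') ^+ 2);
  calib_dark : forall (k j m : int) x y x' y', k = j + 2 * m + 1 ->
    k%:~R < x < (k + 1)%:~R -> j%:~R < y < (j + 1)%:~R ->
    k%:~R < x' < (k + 1)%:~R -> j%:~R < y' < (j + 1)%:~R ->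
    `|phi x y - phi x' y'| <= beta * Num.sqrt ((x - x') ^+ 2 + (y - y') ^+ 2) }.

Lemma int_or_between x : (exists k : int, x = k%:~R) \/
  (exists k : int, k%:~R < x < (k + 1)%:~R).
Proof.
have /andP[x1 x2] := floor_itv x.
have [->|xk] := eqVneq x (Num.floor x)%:~R; first by left; eexists.
by right; exists (Num.floor x); rewrite x2 andbT lt_neqAle eq_sym xk.
Qed.

Lemma near_between u t (a : R) (k : int) : is_derive t 1 u a ->
  k%:~R < u t < (k + 1)%:~R -> \forall s \near t, k%:~R < u s < (k + 1)%:~R.
Proof.
move=> [du _] /andP[u1 u2].
have cu : {for t, continuous u}.
  by apply: differentiable_continuous; exact/derivable1_diffP.
near=> s; apply/andP; split; near: s.
  exact: (cvgr_gt _ cu).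
exact: (cvgr_lt _ cu).
Unshelve. all: by end_near. Qed.

(** On a grid line the increment of [phi] is split into a part along the line, bounded by the
    constant 1 of the line, and a part normal to it, which is negligible to first order since the
    normal velocity is 0. In an open square the curve stays in that square for nearby times. *)
Lemma calibration_derive beta phi (u1 u2 : R -> R) t (f a b : R) : 1 <= beta ->
  calibration beta phi ->
  is_derive t 1 (fun s => phi (u1 s) (u2 s)) f ->
  is_derive t 1 u1 a -> is_derive t 1 u2 b ->
  (forall k : int, u1 t = k%:~R -> a = 0) -> (forall k : int, u2 t = k%:~R -> b = 0) ->
  `|f| <= chess beta (u1 t) (u2 t) * Num.sqrt (a ^+ 2 + b ^+ 2).
Proof.
move=> b1 [[C C0 lip] hor ver light dark]; set F := fun s => phi (u1 s) (u2 s).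
move=> dF d1 d2 a0 b0.
pose D s := Num.sqrt ((u1 s - u1 t) ^+ 2 + (u2 s - u2 t) ^+ 2).
have c1 : 1 * Num.sqrt (a ^+ 2 + b ^+ 2) <=
    chess beta (u1 t) (u2 t) * Num.sqrt (a ^+ 2 + b ^+ 2).
  by rewrite ler_wpM2r ?sqrtr_ge0// chess_ge1.
have [[k uk]|[k uk]] := int_or_between (u1 t).
  apply: le_trans c1; have {}a0 := a0 _ uk; rewrite a0 expr0n add0r sqrtr_sqr mul1r.
  suff H : \forall s \near t, `|F s - F t| <= 0 * D s + C * `|u1 s - u1 t| + 1 * `|u2 s - u2 t|.
    by have := derive_le dF d1 d2 H; rewrite a0 normr0 mulr0 mul0r !add0r mul1r.
  near=> s; rewrite /F uk mul0r add0r mul1r.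
  rewrite (le_trans (ler_distD (phi k%:~R (u2 s)) _ _))// lerD//.
  by rewrite (le_trans (lip _ _ _ _))// subrr normr0 addr0.
have [[j uj]|[j uj]] := int_or_between (u2 t).
  apply: le_trans c1; have {}b0 := b0 _ uj; rewrite b0 expr0n addr0 sqrtr_sqr mul1r.
  suff H : \forall s \near t, `|F s - F t| <= 0 * D s + 1 * `|u1 s - u1 t| + C * `|u2 s - u2 t|.
    by have := derive_le dF d1 d2 H; rewrite b0 normr0 mulr0 mul0r add0r addr0 mul1r.
  near=> s; rewrite /F uj mul0r add0r mul1r [leRHS]addrC.
  rewrite (le_trans (ler_distD (phi (u1 s) j%:~R) _ _))// lerD//.
  by rewrite (le_trans (lip _ _ _ _))// subrr normr0 add0r.
have n1 := near_between d1 uk; have n2 := near_between d2 uj.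
have [m [mE|mE]] := int_parity (k - j).
- have kE : k = j + 2 * m by rewrite -mE addrC subrK.
  rewrite (chess_light beta kE uk uj).
  suff H : \forall s \near t, `|F s - F t| <= 1 * D s + 0 * `|u1 s - u1 t| + 0 * `|u2 s - u2 t|.
    by have := derive_le dF d1 d2 H; rewrite !mul0r !addr0.
  near=> s; rewrite !mul0r !addr0 mul1r.
  by apply: (light k j m) => //; near: s.
- have kE : k = j + 2 * m + 1 by rewrite -addrA -mE addrC subrK.
  rewrite (chess_dark beta kE uk uj).
  suff H : \forall s \near t, `|F s - F t| <= beta * D s + 0 * `|u1 s - u1 t| + 0 * `|u2 s - u2 t|.
    by have := derive_le dF d1 d2 H; rewrite !mul0r !addr0.
  near=> s; rewrite !mul0r !addr0.
  by apply: (dark k j m) => //; near: s.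
Unshelve. all: by end_near. Qed.

Lemma calibration_le beta phi (u1 u2 : R -> R) : 1 <= beta -> calibration beta phi ->
  AC_curve u1 u2 ->
  ((phi (u1 1) (u2 1) - phi (u1 0) (u2 0))%:E <= optical_length beta u1 u2)%E.
Proof.
move=> b1 cal [/abs_cont_acf ac1 /abs_cont_acf ac2].
pose F s := phi (u1 s) (u2 s).
have acF : acf (incr F).
  have [[C C0 lip] _ _ _ _] := cal.
  apply: (@acf_le _ (fun s t => incr u1 s t + incr u2 s t) _ (C + 1)).
  - by rewrite ltr_wpDl.
  - move=> s t _; rewrite /incr /F (le_trans (lip _ _ _ _))//.
    by rewrite ler_wpM2r ?addr_ge0// lerDl.
  - exact: acfD.
have [h1 [_ _ D1]] := acf_derive ac1; have [h2 [_ _ D2]] := acf_derive ac2.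
have [h [ih hE D]] := acf_derive acF.
have N1 := null_crossing u1; have N2 := null_crossing u2.
pose G t := chess beta (u1 t) (u2 t) * Num.sqrt ((derive1 u1 t) ^+ 2 + (derive1 u2 t) ^+ 2).
have [N [mN N0 HN]] : {ae mu, forall t : R, 0 < t < 1 -> `|h t| <= G t}.
  have ? := ae_filter_ringOfSetsType mu.
  apply: (filterS _ (filterI (filterI D1 D2) (filterI D (filterI N1 N2)))).
  move=> t [[E1 E2] [E [M1 M2]]] t01; have t0 : 0 < t by case/andP: t01.
  have {}E1 := E1 t01; have {}E2 := E2 t01; have {}E := E t01.
  rewrite /G !derive1E !derive_val.
  apply: (calibration_derive b1 cal E) => k uk.
    exact: M1 t0 E1 uk.
  exact: M2 t0 E2 uk.
have G0 t : 0 <= G t by rewrite mulr_ge0 ?sqrtr_ge0// (le_trans ler01)// chess_ge1.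
have m01 : measurable (`]0, 1] : set R) by exact: measurable_itv.
have ih01 : mu.-integrable (`]0%R, 1%R] : set R) (EFin \o h).
  by apply: (integrableS measurableT).
rewrite -/(F 1) -/(F 0) hE /Rintegral fineK; last exact: integrable_fin_num.
apply: le_trans (lee_abs _) _.
apply: le_trans (le_abse_integral mu m01 (measurable_int _ ih01)) _.
(* The derivative is controlled on the open interval only, so the end point 1 joins the exceptional
   set. *)
pose N' : set R := N `|` [set 1].
have mN' : measurable N' by apply: measurableU => //; exact: measurable_set1.
have N'0 : mu N' = 0%E.
  by apply: null_set_setU => //; exact: lebesgue_measure_set1.
have -> : (\int[mu]_(t in (`]0%R, 1%R] : set R)) `|(h t)%:E| =
    \int[mu]_(t in `]0%R, 1%R] `\` N') `|(h t)%:E|)%E.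
  by apply: negligible_integral => //; exact: integrable_abse.
apply: ge0_le_integral_nonmeasurable => [t []|||t []].
- by move=> t01 _; exact: subset_itv_oc_cc t01.
- by move=> t _; exact: abse_ge0.
- by move=> t _; rewrite lee_fin; exact: G0.
- rewrite /= in_itv/= => /andP[t0 t1] /not_orP[nN /eqP t_neq1].
  rewrite lee_fin; apply: contrapT => hG; apply: nN; apply: HN => /= H; apply: hG.
  by apply: H; rewrite t0 lt_neqAle t_neq1.
Qed.

End LowerBound.

(** * A piecewise affine potential *)

Section Potential.
Variable R : realType.
Implicit Types (f g : R -> R -> R) (x y : R).

Definition lipschitz2 (K : R) f := forall x y x' y',
  `|f x y - f x' y'| <= K * Num.sqrt ((x - x') ^+ 2 + (y - y') ^+ 2).

Lemma lipschitz2_max K f g : lipschitz2 K f -> lipschitz2 K g ->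
  lipschitz2 K (fun x y => Num.max (f x y) (g x y)).
Proof.
move=> Hf Hg x y x' y'; have := Hf x y x' y'; have := Hg x y x' y'.
rewrite !ler_norml => /andP[? ?] /andP[? ?].
by case: (leP (f x y)); case: (leP (f x' y')) => ? ?; apply/andP; split; lra.
Qed.

Lemma lipschitz2_min K f g : lipschitz2 K f -> lipschitz2 K g ->
  lipschitz2 K (fun x y => Num.min (f x y) (g x y)).
Proof.
move=> Hf Hg x y x' y'; have := Hf x y x' y'; have := Hg x y x' y'.
rewrite !ler_norml => /andP[? ?] /andP[? ?].
by case: (leP (f x y)); case: (leP (f x' y')) => ? ?; apply/andP; split; lra.
Qed.

Lemma cauchy_schwarz2 (K p q a b : R) : 0 <= K -> p ^+ 2 + q ^+ 2 <= K ^+ 2 ->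
  `|p * a + q * b| <= K * Num.sqrt (a ^+ 2 + b ^+ 2).
Proof.
move=> K0 pq; have s0 := sqrtr_ge0 (a ^+ 2 + b ^+ 2).
rewrite -(@ler_pXn2r _ 2)// ?nnegrE ?mulr_ge0// real_normK ?num_real//.
have ab0 : 0 <= a ^+ 2 + b ^+ 2 by rewrite addr_ge0 ?sqr_ge0.
rewrite exprMn sqr_sqrtr//; apply: le_trans (ler_wpM2r ab0 pq).
by rewrite -subr_ge0; apply: le_trans (sqr_ge0 (p * b - q * a)) _; rewrite le_eqVlt; apply/orP; left; apply/eqP; ring.
Qed.

Lemma lipschitz2_affine K p q d f : 0 <= K -> p ^+ 2 + q ^+ 2 <= K ^+ 2 ->
  (forall x y, f x y = p * x + q * y + d) -> lipschitz2 K f.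
Proof.
move=> K0 pq fE x y x' y'; rewrite !fE.
have -> : p * x + q * y + d - (p * x' + q * y' + d) = p * (x - x') + q * (y - y') by ring.
exact: cauchy_schwarz2.
Qed.

(** The points are joined through the integers between them; on ordered points the distances add up,
    so the constant does not grow. *)
Lemma lipschitz_glue (K : R) (f : R -> R) : (forall (j : int) y y',
    j%:~R <= y <= (j + 1)%:~R -> j%:~R <= y' <= (j + 1)%:~R -> `|f y - f y'| <= K * `|y - y'|) ->
  forall y y', `|f y - f y'| <= K * `|y - y'|.
Proof.
move=> H y y'; wlog yy' : y y' / y <= y'.
  move=> W; have [/W//|/ltW/W] := leP y y'.
  by rewrite distrC (distrC y').
have step (n : nat) : forall z, y <= z -> z <= (Num.floor y + 1 + n%:Z)%:~R ->
    `|f y - f z| <= K * `|y - z|.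
  have /andP[fy1 fy2] := floor_itv y.
  elim: n => [|n ih] z yz zn.
    move: zn; rewrite addr0 => zn; apply: (H (Num.floor y)); apply/andP; split=> //.
      exact: ltW.
    exact: le_trans yz.
  have [/ih|zgt] := leP z (Num.floor y + 1 + n%:Z)%:~R; first exact.
  set w := (_ + _ + n%:Z)%:~R in ih zgt.
  have yw : y <= w.
    by rewrite (le_trans (ltW fy2))// ler_int lerDl.
  have := ih w yw (lexx _); have := H (Num.floor y + 1 + n%:Z) w z.
  have -> : `|y - z| = `|y - w| + `|w - z|.
    by rewrite !ler0_norm ?subr_le0//; [ring|exact: ltW].
  rewrite mulrDr => H1 H2; rewrite (le_trans (ler_distD (f w) _ _))// lerD//.
  apply: H1; apply/andP; split=> //; [by rewrite ler_int lerDl|exact: ltW|].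
  by rewrite (le_trans zn)// ler_int; lia.
apply: (step `|Num.floor y' - Num.floor y|%N _ yy').
have /andP[_ fy'] := floor_itv y'; rewrite (le_trans (ltW fy'))// ler_int.
have fyy' : Num.floor y <= Num.floor y' by rewrite le_floor.
rewrite gez0_abs ?subr_ge0//.
by have -> : Num.floor y + 1 + (Num.floor y' - Num.floor y) = Num.floor y' + 1 by ring.
Qed.

Variables beta r A B s del c : R.

(** On the unit square with light vertices at [(0, 0)] and [(1, 1)]. Three pieces have unit
    gradient: [(r, r)] along the diagonal, [(A, s)] along the first leg of an S_3-path leaving
    [(0, 0)], and [(A, s)] again, normalized to [del + c] at [(1, 1)], along a last leg arriving
    there. The bounds [del * x] and [del * x + c] are the values wanted on the horizontal edges. *)
Definition cell_light x y : R :=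
  Num.max (del * x) (Num.min (del * x + c)
    (Num.min (A * x + s * y + (del + c - A - s)) (Num.max (r * (x + y)) (A * x + s * y)))).

(** On the square with [1 <= x <= 2]. The first line continues pieces of the light cell beyond
    [x = 1] with horizontal slope [del]. The last piece interpolates linearly in [x] between the leg
    leaving [(0, 0)] and the leg arriving at [(3, 1)]; when the S_3-path is tight its gradient is
    [(B, s)], that of the middle leg. *)
Definition cell_dark x y : R :=
  Num.max (Num.max (del * x) (del * (x - 1) + Num.min (del + c - s * (1 - y)) (r * (1 + y))))
    (Num.min (del * x + c) (Num.min (del * x + r * y)
       (A + s * y + (3 * del + c - 2 * A - s) * (x - 1)))).

(** The cost comparisons for the three kinds of steps are [adm_del1], [adm_diag] and [adm_S3]. Most
    of the other inequalities order the affine pieces on the edges, so that the cells fit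
    together. *)
Record admissible : Prop := Admissible {
  adm_beta : 1 <= beta; adm_beta2 : 3 / 2 <= beta ^+ 2;
  adm_r : 0 < r; adm_r2 : 2 * r ^+ 2 = 1;
  adm_s : 0 < s; adm_sr : s <= r; adm_A : A ^+ 2 + s ^+ 2 = 1;
  adm_A0 : 0 < A; adm_B0 : 0 < B; adm_B : B ^+ 2 + s ^+ 2 = beta ^+ 2;
  adm_Adel : A <= del; adm_del1 : del <= 1; adm_rdel : r <= del;
  adm_c0 : 0 <= c; adm_c : c <= r; adm_diag : del + c <= 2 * r;
  adm_As : A + s <= del + c; adm_S3 : 3 * del + c <= 2 * A + B + s }.

Hypothesis adm : admissible.

Lemma cell_light_lip : lipschitz2 1 cell_light.
Proof.
case: adm => *; apply: lipschitz2_max; [|apply: lipschitz2_min; [|apply: lipschitz2_min; [|apply: lipschitz2_max]]].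
- by apply: (@lipschitz2_affine _ del 0 0) => [||x y]; [lra|nra|ring].
- by apply: (@lipschitz2_affine _ del 0 c) => [||x y]; [lra|nra|ring].
- by apply: (@lipschitz2_affine _ A s (del + c - A - s)) => [||x y]; [lra|nra|ring].
- by apply: (@lipschitz2_affine _ r r 0) => [||x y]; [lra|nra|ring].
- by apply: (@lipschitz2_affine _ A s 0) => [||x y]; [lra|nra|ring].
Qed.

Lemma cell_dark_lip : lipschitz2 beta cell_dark.
Proof.
case: adm => *; have b0 : 0 <= beta by lra.
have -> : cell_dark = fun x y =>
  Num.max (Num.max (del * x) (Num.min (del * (x - 1) + (del + c - s * (1 - y))) (del * (x - 1) + r * (1 + y))))
    (Num.min (del * x + c) (Num.min (del * x + r * y)
       (A + s * y + (3 * del + c - 2 * A - s) * (x - 1)))).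
  by apply/funext => x; apply/funext => y; rewrite /cell_dark addr_minr.
apply: lipschitz2_max; [apply: lipschitz2_max; [|apply: lipschitz2_min]|
  apply: lipschitz2_min; [|apply: lipschitz2_min]].
- by apply: (@lipschitz2_affine _ del 0 0) => [||x y]; [lra|nra|ring].
- by apply: (@lipschitz2_affine _ del s (c - s)) => [||x y]; [lra|nra|ring].
(* Here [beta ^ 2 >= 3 / 2] enters: the squared gradient is [del ^ 2 + r ^ 2 <= 1 + 1 / 2]. *)
- by apply: (@lipschitz2_affine _ del r (r - del)) => [||x y]; [lra|nra|ring].
- by apply: (@lipschitz2_affine _ del 0 c) => [||x y]; [lra|nra|ring].
- by apply: (@lipschitz2_affine _ del r 0) => [||x y]; [lra|nra|ring].
(* The horizontal slope lies between 0 and [B]; the upper bound is exactly the S_3 comparison, and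
   [B ^ 2 + s ^ 2 = beta ^ 2]. *)
- apply: (@lipschitz2_affine _ (3 * del + c - 2 * A - s) s (A - (3 * del + c - 2 * A - s))) => [||x y]; [lra| |ring].
  have k0 : 0 <= 3 * del + c - 2 * A - s by lra.
  have kB : 3 * del + c - 2 * A - s <= B by lra.
  rewrite -(adm_B adm) lerD2r; nra.
Qed.

Ltac minmax_free a := lazymatch a with
  | context [Order.min _ _] => fail | context [Order.max _ _] => fail | _ => idtac end.
Ltac cases_minmax := repeat match goal with
  | |- context [Order.min ?a ?b] => minmax_free a; minmax_free b; case: (leP a b) => ?
  | |- context [Order.max ?a ?b] => minmax_free a; minmax_free b; case: (leP a b) => ? end.

Lemma cell_bottom x : (0 <= x <= 1 -> cell_light x 0 = del * x) /\
  (1 <= x <= 2 -> cell_dark x 0 = del * x).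
Proof.
case: adm => *; split=> /andP[x0 x1]; rewrite /cell_light/cell_dark.
- have ? : 0 <= (del - A) * x by nra.
  have ? : 0 <= (del - r) * x by nra.
  by rewrite max_l// ge_min; apply/orP; right; rewrite ge_min; apply/orP; right; rewrite ge_max; apply/andP; split; lra.
- rewrite [X in Num.max X _]max_l.
    by rewrite max_l// ge_min; apply/orP; right; rewrite ge_min; apply/orP; left; lra.
  rewrite -lerBrDl ge_min; apply/orP; right; lra.
Qed.

Lemma cell_top x : (0 <= x <= 1 -> cell_light x 1 = del * x + c) /\
  (1 <= x <= 2 -> cell_dark x 1 = del * x + c).
Proof.
case: adm => *; split=> /andP[x0 x1]; rewrite /cell_light/cell_dark.
- have ? : 0 <= (del - A) * (1 - x) by nra.
  have ? : 0 <= (del - r) * (1 - x) by nra.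
  rewrite [X in Num.max _ X]min_l; first by rewrite max_r//; lra.
  by rewrite le_min; apply/andP; split; [lra|rewrite le_max; apply/orP; left; lra].
- rewrite [Num.min _ (r * _)]min_l; last lra.
  rewrite [X in Num.max X _]max_r; last lra.
  rewrite max_l; first by lra.
  rewrite ge_min; apply/orP; left; lra.
Qed.

(** With [P], [Q], [S] the values of the three unit-gradient pieces on this edge and [S <= P],
    distributivity reduces both sides to the maximum of [del], [min P Q] and [S]. *)
Lemma cell_right y : 0 <= y <= 1 -> cell_light 1 y = cell_dark 1 y.
Proof.
move=> /andP[y0 y1]; case: adm => *; rewrite /cell_light /cell_dark subrr !mulr0 !mulr1 add0r addr0.
set P := A + s * y + (del + c - A - s); set Q := r * (1 + y); set S := A + s * y.
have -> : del + c - s * (1 - y) = P by rewrite /P; ring.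
have SP : S <= P by rewrite /S /P; lra.
have Pc : P <= del + c by rewrite /P; nra.
have Sd : S <= del + r * y by rewrite /S; nra.
rewrite [Num.min (del + c) (Num.min P _)]min_r; last by rewrite ge_min Pc.
rewrite [Num.min (del + r * y) _]min_r// [Num.min (del + c) S]min_r; last exact: le_trans Pc.
clearbody P Q S; clear -SP.
by cases_minmax; lra.
Qed.

(** At [x = 2] the pieces on the first line of [cell_dark] are dominated by the minimum on its
    second line, and this minimum is the next light cell at [x = 0] raised by [2 * del]. *)
Lemma cell_left y : 0 <= y <= 1 -> cell_dark 2 y = 2 * del + cell_light 0 y.
Proof.
move=> /andP[y0 y1]; case: adm => *; rewrite /cell_light /cell_dark !mulr0 !add0r.
set M := s * y + (del + c - A - s).
have -> : A + s * y + (3 * del + c - 2 * A - s) * (2 - 1) = 2 * del + M by rewrite /M; ring.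
have ? : s * y <= r * y by nra.
have ? : 0 <= r * y by nra.
have ? : 0 <= s * y by nra.
have M0 : 0 <= M by rewrite /M; lra.
have gM : del * (2 - 1) + (del + c - s * (1 - y)) <= 2 * del + M by rewrite /M; lra.
have gM2 : del * (2 - 1) + (r * (1 + y)) <= 2 * del + r * y by lra.
have gM3 : del * (2 - 1) + (del + c - s * (1 - y)) <= 2 * del + c by nra.
rewrite [Num.max (r * y) _]max_l//.
have -> : Num.min (del * 2 + c) (Num.min (del * 2 + r * y) (2 * del + M)) =
    2 * del + Num.min c (Num.min M (r * y)).
  by rewrite !addr_minr [del * 2]mulrC [Num.min (_ + M) _]minC.
rewrite [Num.max 0 _]max_r; last by rewrite !le_min; apply/and3P; split.
rewrite max_r//; have I a : a <= 2 * del + c -> a <= 2 * del + M -> a <= 2 * del + r * y ->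
    a <= 2 * del + Num.min c (Num.min M (r * y)).
  by rewrite !addr_minr !le_min => -> -> ->.
rewrite ge_max; apply/andP; split; first by apply: I; lra.
by rewrite addr_minr; apply: I; rewrite ge_min; apply/orP; [left|left|right].
Qed.

End Potential.

(** * Gluing the cells into a potential on the plane *)

Section GlobalPotential.
Variable R : realType.
Variables beta r A B s del c : R.
Hypothesis adm : admissible beta r A B s del c.
Implicit Types x y : R.

Local Notation cell_light := (cell_light r A s del c).
Local Notation cell_dark := (cell_dark r A s del c).

Definition strip x y : R := let m := Num.floor (x / 2) in
  2 * del * m%:~R + (if x - 2 * m%:~R <= 1 then cell_light (x - 2 * m%:~R) y
                     else cell_dark (x - 2 * m%:~R) y).

(** Translation by [(1, 1)] preserves the chessboard and adds [del + c], so every strip is a copy of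
    the strip between heights 0 and 1; translation by [(2, 0)] adds [2 * del]. *)
Definition potential x y : R := let j := Num.floor y in
  (del + c) * j%:~R + strip (x - j%:~R) (y - j%:~R).

Lemma strip_light (m : int) x y : 2 * m%:~R <= x <= 2 * m%:~R + 1 ->
  strip x y = 2 * del * m%:~R + cell_light (x - 2 * m%:~R) y.
Proof.
move=> /andP[x0 x1]; rewrite /strip (_ : Num.floor (x / 2) = m).
  by rewrite ifT//; lra.
by apply: floor_def; rewrite intrD; apply/andP; split; lra.
Qed.

Lemma strip_dark (m : int) x y : 0 <= y <= 1 -> 2 * m%:~R + 1 <= x <= 2 * m%:~R + 2 ->
  strip x y = 2 * del * m%:~R + cell_dark (x - 2 * m%:~R) y.
Proof.
move=> y01 /andP[x0 x1].
have [xE|xn] := eqVneq x (2 * m%:~R + 1).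
  rewrite (@strip_light m) ?xE; last by apply/andP; split; lra.
  by rewrite [_ + 1]addrC addrK (cell_right adm).
have [xE|xn2] := eqVneq x (2 * m%:~R + 2).
  rewrite (@strip_light (m + 1)) ?xE; last by rewrite intrD; apply/andP; split; lra.
  rewrite intrD (_ : _ + 2 - 2 * _ = 0); last by ring.
  by rewrite (_ : _ + 2 - _ = 2) ?(cell_left adm)//; ring.
have x0' : 2 * m%:~R + 1 < x by rewrite lt_neqAle eq_sym xn.
have x1' : x < 2 * m%:~R + 2 by rewrite lt_neqAle xn2.
rewrite /strip (_ : Num.floor (x / 2) = m).
  by rewrite ifF//; apply/negbTE; rewrite -ltNge; lra.
by apply: floor_def; rewrite intrD; apply/andP; split; lra.
Qed.

Lemma strip_cases x : exists m : int,
  2 * m%:~R <= x <= 2 * m%:~R + 1 \/ 2 * m%:~R + 1 <= x <= 2 * m%:~R + 2.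
Proof.
exists (Num.floor (x / 2)); have := floor_itv (x / 2); rewrite intrD => /andP[x0 x1].
by have [?|?] := leP x (2 * (Num.floor (x / 2))%:~R + 1); [left|right]; apply/andP; split; lra.
Qed.

Lemma strip_bottom x : strip x 0 = del * x.
Proof.
have [m [x01|x12]] := strip_cases x.
  rewrite (strip_light _ x01) (cell_bottom adm _).1; first by ring.
  by case/andP: x01 => *; apply/andP; split; lra.
rewrite (@strip_dark m) ?lexx ?ler01// (cell_bottom adm _).2; first by ring.
by case/andP: x12 => *; apply/andP; split; lra.
Qed.

Lemma strip_top x : strip x 1 = del * x + c.
Proof.
have [m [x01|x12]] := strip_cases x.
  rewrite (strip_light _ x01) (cell_top adm _).1; first by ring.
  by case/andP: x01 => *; apply/andP; split; lra.
rewrite (@strip_dark m) ?lexx ?ler01// (cell_top adm _).2; first by ring.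
by case/andP: x12 => *; apply/andP; split; lra.
Qed.

Lemma potential_horizontal x (j : int) : potential x j%:~R = del * x + c * j%:~R.
Proof. by rewrite /potential intrKfloor subrr strip_bottom; ring. Qed.

Lemma potential_strip (j : int) x y : j%:~R <= y <= (j + 1)%:~R ->
  potential x y = (del + c) * j%:~R + strip (x - j%:~R) (y - j%:~R).
Proof.
move=> /andP[y0 y1]; have [->|yn] := eqVneq y (j + 1)%:~R.
  by rewrite potential_horizontal intrD addrAC subrr add0r strip_top; ring.
rewrite /potential (_ : Num.floor y = j)//.
by apply: floor_def; rewrite y0 lt_neqAle yn.
Qed.

Lemma potential_light (k j m : int) x y : k = j + 2 * m ->
  k%:~R <= x <= (k + 1)%:~R -> j%:~R <= y <= (j + 1)%:~R ->
  potential x y = (del + c) * j%:~R + 2 * del * m%:~R + cell_light (x - k%:~R) (y - j%:~R).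
Proof.
move=> -> xr y01; move: xr; rewrite !intrD !intrM => /andP[x0 x1].
rewrite (potential_strip _ y01) (@strip_light m); last by apply/andP; split; lra.
by rewrite addrA opprD addrA.
Qed.

Lemma potential_dark (k j m : int) x y : k = j + 2 * m + 1 ->
  k%:~R <= x <= (k + 1)%:~R -> j%:~R <= y <= (j + 1)%:~R ->
  potential x y = (del + c) * j%:~R + 2 * del * m%:~R + cell_dark (x - k%:~R + 1) (y - j%:~R).
Proof.
move=> -> xr y01; move: xr; rewrite !intrD !intrM => /andP[x0 x1].
rewrite (potential_strip _ y01) (@strip_dark m); last by apply/andP; split; lra.
  rewrite -!addrA; congr (_ + (_ + cell_dark _ _)); ring.
by move: y01; rewrite intrD => /andP[? ?]; apply/andP; split; lra.
Qed.

Lemma potential_cell (k j : int) x y x' y' :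
  k%:~R <= x <= (k + 1)%:~R -> j%:~R <= y <= (j + 1)%:~R ->
  k%:~R <= x' <= (k + 1)%:~R -> j%:~R <= y' <= (j + 1)%:~R ->
  `|potential x y - potential x' y'| <= beta * Num.sqrt ((x - x') ^+ 2 + (y - y') ^+ 2).
Proof.
move=> kx jy kx' jy'; have b1 := adm_beta adm.
have [m [mE|mE]] := int_parity (k - j).
- have kE : k = j + 2 * m by rewrite -mE addrC subrK.
  rewrite !(@potential_light k j m)// opprD addrACA subrr add0r.
  rewrite (le_trans (cell_light_lip adm _ _ _ _))//.
  rewrite (_ : x - _ - _ = x - x'); last by ring.
  rewrite (_ : y - _ - _ = y - y'); last by ring.
  by rewrite ler_wpM2r ?sqrtr_ge0.
- have kE : k = j + 2 * m + 1 by rewrite -addrA -mE addrC subrK.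
  rewrite !(@potential_dark k j m)// opprD addrACA subrr add0r.
  rewrite (le_trans (cell_dark_lip adm _ _ _ _))//.
  rewrite (_ : x - _ + 1 - _ = x - x'); last by ring.
  by rewrite (_ : y - _ - _ = y - y')//; ring.
Qed.

Lemma calibration_potential : calibration beta potential.
Proof.
have b1 := adm_beta adm; have b0 : 0 <= beta by lra.
have W (a : R) (i : int) : i%:~R < a < (i + 1)%:~R -> i%:~R <= a <= (i + 1)%:~R.
  by move=> /andP[/ltW -> /ltW ->].
split.
- exists beta => // x y x' y'.
  rewrite (le_trans (ler_distD (potential x' y) _ _))// mulrDr lerD//.
    apply: (lipschitz_glue (f := fun x => potential x y)) => k {}x {}x' kx kx'.
    have /andP[y0 y1] := floor_itv y.
    have jy : (Num.floor y)%:~R <= y <= (Num.floor y + 1)%:~R by rewrite y0 ltW.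
    have := potential_cell kx jy kx' jy.
    by rewrite subrr expr0n addr0 sqrtr_sqr.
  apply: (lipschitz_glue (f := fun y => potential x' y)) => j {}y {}y' jy jy'.
  have /andP[x0 x1] := floor_itv x'.
  have kx : (Num.floor x')%:~R <= x' <= (Num.floor x' + 1)%:~R by rewrite x0 ltW.
  have := potential_cell kx jy kx jy'.
  by rewrite subrr expr0n add0r sqrtr_sqr.
- move=> j x x'; rewrite !potential_horizontal opprD addrACA subrr addr0 -mulrBr normrM.
  have ? := adm_del1 adm; have ? := adm_rdel adm; have ? := adm_r adm.
  by rewrite ler_piMl// ger0_norm//; lra.
(* Each unit edge of a vertical line bounds a light square, on its right when [k - j] is even and on
   its left when [k - j] is odd. The closed light cell gives the constant 1. *)
- move=> k y y'; rewrite -[leRHS]mul1r.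
  apply: (lipschitz_glue (f := fun y => potential k%:~R y)) => j {}y {}y' jy jy'.
  have [m [mE|mE]] := int_parity (k - j).
    have kE : k = j + 2 * m by rewrite -mE addrC subrK.
    have kx : k%:~R <= (k%:~R : R) <= (k + 1)%:~R by rewrite lexx ler_int lerDl.
    rewrite !(@potential_light k j m)// opprD addrACA subrr add0r.
    rewrite (le_trans (cell_light_lip adm _ _ _ _))// subrr expr0n add0r sqrtr_sqr.
    by rewrite (_ : y - _ - _ = y - y')//; ring.
  have kE : k - 1 = j + 2 * m by rewrite -[k](subrK j) mE; ring.
  have kx : (k - 1)%:~R <= (k%:~R : R) <= (k - 1 + 1)%:~R.
    by rewrite subrK lexx ler_int gerBl.
  rewrite !(@potential_light (k - 1) j m)// opprD addrACA subrr add0r.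
  rewrite (le_trans (cell_light_lip adm _ _ _ _))// subrr expr0n add0r sqrtr_sqr.
  by rewrite (_ : y - _ - _ = y - y')//; ring.
- move=> k j m x y x' y' kE kx jy kx' jy'.
  rewrite !(@potential_light k j m) ?W// opprD addrACA subrr add0r.
  rewrite (le_trans (cell_light_lip adm _ _ _ _))// mul1r.
  rewrite (_ : x - _ - _ = x - x'); last by ring.
  by rewrite (_ : y - _ - _ = y - y')//; ring.
- move=> k j m x y x' y' kE kx jy kx' jy'.
  by apply: (@potential_cell k j); exact: W.
Qed.

End GlobalPotential.

(** * Polygonal competitors *)

Section UpperBound.
Import numFieldNormedType.Exports.
Variable R : realType.
Notation mu := (@lebesgue_measure R).
Variable beta : R.
Hypothesis beta1 : 1 <= beta.
Implicit Types x y l : R.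

(** The end points are left out: they may lie on grid lines, where the medium jumps, and they carry
    no length. *)
Definition segment_le x y x' y' l := forall s : R, 0 < s < 1 ->
  chess beta (x + s * (x' - x)) (y + s * (y' - y)) *
    Num.sqrt ((x' - x) ^+ 2 + (y' - y) ^+ 2) <= l.

Inductive polyline : R -> R -> R -> Prop :=
| polyline_nil : polyline 0 0 0
| polyline_cons x y l x' y' l' : polyline x y l -> 0 <= l' ->
    segment_le x y x' y' l' -> polyline x' y' (l + l').

Lemma polyline_vertices x y l : polyline x y l ->
  exists (n : nat) (X Y C : nat -> R), [/\ [/\ (0 < n)%N, X 0%N = 0, Y 0%N = 0, X n = x & Y n = y],
    exists K, forall i, `|X i.+1 - X i| <= K /\ `|Y i.+1 - Y i| <= K,
    forall i, 0 <= C i,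
    forall i, (i < n)%N -> segment_le (X i) (Y i) (X i.+1) (Y i.+1) (C i) &
    l = \sum_(i < n) C i].
Proof.
elim=> [|{}x {}y {}l x' y' l' _ [n [X [Y [C [[n0 X0 Y0 Xn Yn] [K HK] C0 HC lE]]]]] l'0 Hl'].
  (* A degenerate segment at the origin keeps the number [n] of segments positive, since the
     parametrization runs through [n%:R * t]. *)
  exists 1%N, (fun=> 0), (fun=> 0), (fun=> 0); split=> //; last by rewrite big_ord1.
    by exists 0 => i; rewrite subrr normr0.
  by move=> i _ s _; rewrite subrr expr0n addr0 sqrtr0 mulr0.
exists n.+1, (fun i => if (i <= n)%N then X i else x'), (fun i => if (i <= n)%N then Y i else y'),
  (fun i => if (i < n)%N then C i else l'); split.
- by split; rewrite ?leq0n ?ltnn.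
- exists (Num.max K (Num.max `|x' - x| `|y' - y|)) => i.
  case: (ltngtP i n) => [lt|gt|->].
  + by rewrite !le_max; have [-> ->] := HK i.
  + by rewrite !subrr normr0 !le_max normr_ge0 orbT.
  + by rewrite Xn Yn !le_max !lexx !orbT.
- by move=> i; case: ifP.
- move=> i; rewrite ltnS leq_eqVlt; case: (ltngtP i n) => [lt _|//|-> _].
    exact: HC.
  by rewrite Xn Yn.
- rewrite big_ord_recr/= ltnn lE; congr (_ + _).
  by apply: eq_bigr => i _; rewrite ltn_ord.
Qed.

Definition interpolate (X : nat -> R) (s : R) : R :=
  X (Num.truncn s) + (s - (Num.truncn s)%:R) * (X (Num.truncn s).+1 - X (Num.truncn s)).

Lemma interpolateE X (i : nat) s : i%:R <= s <= i.+1%:R ->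
  interpolate X s = X i + (s - i%:R) * (X i.+1 - X i).
Proof.
move=> /andP[s0 s1]; have [->|sn] := eqVneq s i.+1%:R.
  by rewrite /interpolate natrK subrr mul0r addr0 -natr1 addrAC subrr add0r mul1r addrC subrK.
rewrite /interpolate (_ : Num.truncn s = i)//.
by apply/eqP; rewrite truncn_eq ?s0 ?lt_neqAle ?sn//; exact: le_trans s0.
Qed.

Lemma interpolate_neg X s : s <= 0 -> interpolate X s = X 0%N + s * (X 1%N - X 0%N).
Proof.
rewrite le_eqVlt => /predU1P[->|s0]; first by rewrite (@interpolateE _ 0) ?lexx ?ler01 ?subr0.
rewrite /interpolate (_ : Num.truncn s = 0%N) ?subr0//.
by rewrite truncn_floor ifN// -ltNge.
Qed.

(** Valid on the whole line: for negative arguments [truncn] is 0 and the first segment is extended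
    affinely. *)
Lemma interpolate_lipschitz X K : (forall i, `|X i.+1 - X i| <= K) ->
  forall s s', `|interpolate X s - interpolate X s'| <= K * `|s - s'|.
Proof.
move=> HK; apply: lipschitz_glue => -[i|i] s s' /andP[s0 s1] /andP[s'0 s'1].
  rewrite !(@interpolateE _ i) ?s0 ?s'0 -?natr1//= ?s1 ?s'1; last 2 first.
  - by rewrite natr1; move: s'1; rewrite -PoszD addn1.
  - by rewrite natr1; move: s1; rewrite -PoszD addn1.
  rewrite opprD addrACA subrr add0r -mulrBl normrM mulrC.
  by rewrite opprB addrA subrK ler_wpM2r.
have i0 : (Negz i + 1)%:~R <= 0 :> R by rewrite lerz0; lia.
rewrite !interpolate_neg ?(le_trans s1) ?(le_trans s'1)//.
by rewrite opprD addrACA subrr add0r -mulrBl normrM mulrC ler_wpM2r.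
Qed.

Lemma interpolate_derive X n (i : nat) (t : R) : i%:R < n%:R * t < i.+1%:R ->
  is_derive t 1 (fun t : R => interpolate X (n%:R * t)) (n%:R * (X i.+1 - X i)).
Proof.
move=> /andP[t0 t1].
have cn : {for t, continuous (fun t : R => n%:R * t)} by exact: mulrl_continuous.
apply: (@near_eq_is_derive _ _ _ (fun t : R => X i + (n%:R * t - i%:R) * (X i.+1 - X i))).
  near=> s; rewrite (@interpolateE _ i)//; apply/andP; split; apply: ltW; near: s.
    exact: (cvgr_gt _ cn).
  exact: (cvgr_lt _ cn).
apply: is_derive_eq; rewrite /GRing.scale/=; ring.
Unshelve. all: by end_near. Qed.

Lemma lipschitz_abs_cont (K : R) (f : R -> R) :
  (forall s t, `|f s - f t| <= K * `|s - t|) -> abs_cont_on 0 1 f.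
Proof.
move=> HK; have K0 : 0 <= K.
  by have := HK 1 0; rewrite subr0 normr1 mulr1; apply: le_trans.
move=> e e0; exists (e / (K + 1)); first by rewrite divr_gt0// ltr_wpDl.
move=> n s t H1 H2 Hd; apply: (@le_lt_trans _ _ ((K + 1) * \sum_(k < n) (t k - s k))).
  rewrite mulr_sumr; apply: ler_sum => k _; have [_ [st _]] := H1 _ (ltn_ord k).
  by rewrite (le_trans (HK _ _))// ger0_norm ?subr_ge0// ler_wpM2r ?subr_ge0// lerDl.
by rewrite mulrC -ltr_pdivlMr// ltr_wpDl.
Qed.

Lemma polyline_curve x y l : polyline x y l -> exists v1 v2 : R -> R,
  [/\ AC_curve v1 v2, v1 0 = 0 /\ v2 0 = 0, v1 1 = x /\ v2 1 = y &
      (optical_length beta v1 v2 <= l%:E)%E].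
Proof.
move=> /polyline_vertices[n [X [Y [C [[n0 X0 Y0 Xn Yn] [K HK] C0 HC ->]]]]].
have nR : 0 < n%:R :> R by rewrite ltr0n.
exists (fun t => interpolate X (n%:R * t)), (fun t => interpolate Y (n%:R * t)).
have ac Z : (forall i, `|Z i.+1 - Z i| <= K) -> abs_cont_on 0 1 (fun t => interpolate Z (n%:R * t)).
  move=> HZ; apply: (@lipschitz_abs_cont (K * n%:R)) => s t.
  rewrite (le_trans (interpolate_lipschitz HZ _ _))// -mulrBr normrM.
  by rewrite normr_nat mulrA.
split.
- by split; apply: ac => i; have [] := HK i.
- by rewrite mulr0 !(@interpolateE _ 0) ?lexx ?ler01 ?subrr ?mul0r ?addr0.
- by rewrite mulr1 !(@interpolateE _ n) ?lexx ?ler_nat ?leqnSn ?subrr ?mul0r ?addr0.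
set v1 := fun t => _; set v2 := fun t => interpolate Y _.
pose G t := chess beta (v1 t) (v2 t) * Num.sqrt ((derive1 v1 t) ^+ 2 + (derive1 v2 t) ^+ 2).
have G0 t : 0 <= G t by rewrite mulr_ge0 ?sqrtr_ge0// (le_trans ler01)// chess_ge1.
pose I (i : nat) : set R := [set` `]i%:R / n%:R, i.+1%:R / n%:R[].
(* A measurable majorant of the integrand: the constant speed bound [n * C i] inside each parameter
   interval, and at each node the actual value of the integrand, whatever [derive1] is there, on a
   null set. *)
pose g (t : R) : \bar R := (\sum_(i < n) ((n%:R * C i) * \1_(I i) t)%:E +
  \sum_(i < n.+1) (G (i%:R / n%:R) * \1_[set i%:R / n%:R] t)%:E)%E.
have mI i : measurable (I i) by exact: measurable_itv.
have T1 i t : 0 <= n%:R * C i * \1_(I i) t by rewrite mulr_ge0// mulr_ge0.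
have T2 i t : 0 <= G (i%:R / n%:R) * \1_[set i%:R / n%:R] t by rewrite mulr_ge0.
have int_indic (a : R) (A : set R) : 0 <= a -> measurable A ->
    (\int[mu]_(t in `[0%R, 1%R]) (a * \1_A t)%:E <= a%:E * mu A)%E.
  move=> a0 mA; under eq_integral do rewrite EFinM.
  rewrite ge0_integralZl_EFin//; last first.
    by apply/measurable_EFinP; apply: measurable_funTS; exact: measurable_indic.
  rewrite integral_indic//.
  apply: lee_wpmul2l; first by rewrite lee_fin.
  by apply: le_measure; rewrite ?inE//; apply: measurableI => //; exact: measurable_itv.
have m_indic (a : R) (A : set R) : measurable A ->
    measurable_fun (`[0%R, 1%R] : set R) (fun t => (a * \1_A t)%:E).
  move=> mA; apply/measurable_EFinP; apply: measurable_funM.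
    exact: measurable_cst.
  by apply: measurable_funTS; exact: measurable_indic.
apply: (@le_trans _ _ (\int[mu]_(t in `[0%R, 1%R]) g t)%E).
  apply: ge0_le_integral_nonmeasurable => // t.
  - by move=> _; rewrite lee_fin; exact: G0.
  - by move=> _; apply: adde_ge0; apply: sume_ge0 => i _; rewrite lee_fin; [exact: T1|exact: T2].
  rewrite /= in_itv/= => /andP[t0 t1]; rewrite /g !sumEFin -EFinD lee_fin.
  have nt0 : 0 <= n%:R * t by rewrite mulr_ge0.
  have ntn : n%:R * t <= n%:R by rewrite ler_piMr.
  have /andP[it ti] := truncn_itv nt0; set i := Num.truncn _ in it ti.
  have [itE|itn] := eqVneq (i%:R) (n%:R * t).
    have tE : t = i%:R / n%:R by rewrite itE [n%:R * t]mulrC mulfK// gt_eqF.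
    have i_n : (i < n.+1)%N by rewrite ltnS -(ler_nat R) itE.
    rewrite [X in _ <= _ + X](bigD1 (Ordinal i_n))//= -tE indicE mem_set// mulr1 addrCA lerDl.
    by apply: addr_ge0; apply: sumr_ge0 => k _; [exact: T1|exact: T2].
  have it' : i%:R < n%:R * t by rewrite lt_neqAle itn.
  have i_n : (i < n)%N by rewrite -(ltr_nat R) (lt_le_trans it').
  have itt : i%:R < n%:R * t < i.+1%:R by rewrite it' ti.
  rewrite [X in _ <= X + _](bigD1 (Ordinal i_n))//= indicE mem_set; last first.
    by rewrite /I/= in_itv/= ltr_pdivrMr// ltr_pdivlMr// mulrC it' ti.
  rewrite mulr1 -addrA; apply: (@le_trans _ _ (n%:R * C i)); last first.
    by rewrite lerDl; apply: addr_ge0; apply: sumr_ge0 => k _; [exact: T1|exact: T2].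
  have d1 := interpolate_derive X itt; have d2 := interpolate_derive Y itt.
  rewrite /G !derive1E !derive_val !exprMn -mulrDr sqrtrM ?sqr_ge0// sqrtr_sqr.
  rewrite normr_nat mulrCA ler_pM2l// /v1 /v2.
  have itt' : i%:R <= n%:R * t <= i.+1%:R by rewrite it ltW.
  rewrite !(interpolateE _ itt'); apply: (HC i i_n (n%:R * t - i%:R)).
  by rewrite subr_gt0 it' ltrBlDl natr1.
rewrite /g ge0_integralD//; last 4 first.
- by move=> t _; apply: sume_ge0 => i _; rewrite lee_fin; exact: T1.
- by apply: emeasurable_fun_sum => i; exact: m_indic.
- by move=> t _; apply: sume_ge0 => i _; rewrite lee_fin; exact: T2.
- by apply: emeasurable_fun_sum => i; apply: m_indic; exact: measurable_set1.
rewrite !ge0_integral_sum//; last 4 first.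
- by move=> i; apply: m_indic; exact: measurable_set1.
- by move=> i t _; rewrite lee_fin; exact: T2.
- by move=> i; exact: m_indic.
- by move=> i t _; rewrite lee_fin; exact: T1.
rewrite -[leRHS]adde0; apply: leeD.
  rewrite -sumEFin; apply: lee_sum => i _.
  have nC : 0 <= n%:R * C i by rewrite mulr_ge0.
  apply: le_trans (int_indic _ _ nC (mI i)) _.
  rewrite /I lebesgue_measure_itv/= lte_fin ltr_pM2r ?invr_gt0// ltr_nat ltnSn.
  rewrite -EFinD -EFinM lee_fin -mulrBl -natr1 addrAC subrr add0r mul1r.
  by rewrite mulrAC mulfV ?mul1r// gt_eqF.
apply: sume_le0 => i _; apply: le_trans (int_indic _ _ (G0 _) (measurable_set1 _)) _.
by rewrite lebesgue_measure_set1 mule0.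
Qed.

End UpperBound.

(** * Horizontal, diagonal and S_3 steps *)

Section Steps.
Variable R : realType.
Variable beta : R.
Implicit Types x y l : R.

Local Notation polyline := (polyline beta).
Local Notation segment_le := (segment_le beta).

Lemma between_segment (k x x' s : R) : k <= x -> x < x' -> x' <= k + 1 -> 0 < s < 1 ->
  k < x + s * (x' - x) < k + 1.
Proof.
move=> kx xx' xk /andP[s0 s1].
have h1 : 0 < s * (x' - x) by rewrite mulr_gt0 ?subr_gt0.
have h2 : 0 < (1 - s) * (x' - x) by rewrite mulr_gt0 ?subr_gt0.
by apply/andP; split; lra.
Qed.

Lemma segment_light (k j m : int) x y x' y' : k = j + 2 * m ->
  k%:~R <= x -> x < x' -> x' <= k%:~R + 1 -> j%:~R <= y -> y < y' -> y' <= j%:~R + 1 ->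
  segment_le x y x' y' (Num.sqrt ((x' - x) ^+ 2 + (y' - y) ^+ 2)).
Proof.
move=> kE kx xx' xk jy yy' yj s s01.
by rewrite (chess_light beta kE) ?mul1r// intrD; exact: between_segment.
Qed.

Lemma segment_dark (k j m : int) x y x' y' : k = j + 2 * m + 1 ->
  k%:~R <= x -> x < x' -> x' <= k%:~R + 1 -> j%:~R <= y -> y < y' -> y' <= j%:~R + 1 ->
  segment_le x y x' y' (beta * Num.sqrt ((x' - x) ^+ 2 + (y' - y) ^+ 2)).
Proof.
move=> kE kx xx' xk jy yy' yj s s01.
by rewrite (chess_dark beta kE)// intrD; exact: between_segment.
Qed.

Lemma segment_horizontal (j : int) x x' : x <= x' -> segment_le x j%:~R x' j%:~R (x' - x).
Proof.
move=> xx' s _; rewrite subrr mulr0 addr0 chess_horizontal mul1r expr0n addr0 sqrtr_sqr.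
by rewrite ger0_norm// subr_ge0.
Qed.

Lemma polyline_horizontal (j : int) x l (n : nat) : polyline x j%:~R l ->
  polyline (x + 2 * n%:R) j%:~R (l + 2 * n%:R).
Proof.
move=> P; elim: n => [|n ih]; first by rewrite mulr0 !addr0.
have x2 : x + 2 * n%:R <= x + 2 * n.+1%:R by rewrite -[n.+1%:R]natr1; lra.
have := polyline_cons ih _ (@segment_horizontal j _ _ x2).
rewrite (_ : l + _ + _ = l + 2 * n.+1%:R); last by rewrite -[n.+1%:R]natr1; ring.
by apply; rewrite subr_ge0.
Qed.

Lemma polyline_diagonal (k j m : int) l (n : nat) : k = j + 2 * m ->
  polyline k%:~R j%:~R l ->
  polyline (k + n%:Z)%:~R (j + n%:Z)%:~R (l + Num.sqrt 2 * n%:R).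
Proof.
move=> kE P; elim: n => [|n ih]; first by rewrite mulr0 !addr0.
have kE' : k + n%:Z = j + n%:Z + 2 * m by rewrite kE; ring.
have E (i : int) : (i + n.+1%:Z)%:~R = (i + n%:Z)%:~R + 1 :> R.
  by rewrite (_ : i + n.+1%:Z = i + n%:Z + 1) ?[LHS]intrD//; lia.
have S : segment_le (k + n%:Z)%:~R (j + n%:Z)%:~R (k + n.+1%:Z)%:~R (j + n.+1%:Z)%:~R (Num.sqrt 2).
  have -> : 2 = ((k + n.+1%:Z)%:~R - (k + n%:Z)%:~R) ^+ 2 + ((j + n.+1%:Z)%:~R - (j + n%:Z)%:~R) ^+ 2 :> R.
    by rewrite !E; ring.
  by apply: (segment_light kE'); rewrite ?E ?lexx ?ltrDl.
have := polyline_cons ih (sqrtr_ge0 _) S.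
by rewrite -[n.+1%:R]natr1 mulrDr mulr1 addrA.
Qed.

(** The path climbs [t] in each light square and [u] in the dark square between them, so
    [2 * t + u = 1] brings it from a light vertex to the one three columns to the right and one line
    up. *)
Lemma polyline_S3 (t u : R) (k j m : int) l (n : nat) :
  0 <= beta -> 0 < t -> 0 < u -> 2 * t + u = 1 ->
  k = j + 2 * m -> polyline k%:~R j%:~R l ->
  polyline (k + 3 * n%:Z)%:~R (j + n%:Z)%:~R
    (l + (2 * Num.sqrt (1 + t ^+ 2) + beta * Num.sqrt (1 + u ^+ 2)) * n%:R).
Proof.
move=> beta0 t0 u0 tu kE P; elim: n => [|n ih]; first by rewrite !mulr0 !addr0.
set K := (k + 3 * n%:Z) in ih; set J := (j + n%:Z) in ih.
have KE : K = J + 2 * (m + n%:Z) by rewrite /K /J kE; ring.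
have K1E : K + 1 = J + 2 * (m + n%:Z) + 1 by rewrite KE.
have K2E : K + 2 = J + 2 * (m + n%:Z + 1) by rewrite KE; ring.
have -> : k + 3 * n.+1%:Z = K + 3 by rewrite /K; lia.
have -> : j + n.+1%:Z = J + 1 by rewrite /J; lia.
have H1 : segment_le K%:~R J%:~R (K%:~R + 1) (J%:~R + t) (Num.sqrt (1 + t ^+ 2)).
  have -> : 1 + t ^+ 2 = (K%:~R + 1 - K%:~R) ^+ 2 + (J%:~R + t - J%:~R) ^+ 2 by ring.
  by apply: (segment_light KE); lra.
have H2 : segment_le (K%:~R + 1) (J%:~R + t) (K%:~R + 2) (J%:~R + t + u) (beta * Num.sqrt (1 + u ^+ 2)).
  have -> : 1 + u ^+ 2 = (K%:~R + 2 - (K%:~R + 1)) ^+ 2 + (J%:~R + t + u - (J%:~R + t)) ^+ 2 by ring.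
  by apply: (segment_dark K1E); rewrite ?intrD; lra.
have H3 : segment_le (K%:~R + 2) (J%:~R + t + u) (K + 3)%:~R (J + 1)%:~R (Num.sqrt (1 + t ^+ 2)).
  have -> : 1 + t ^+ 2 = ((K + 3)%:~R - (K%:~R + 2)) ^+ 2 + ((J + 1)%:~R - (J%:~R + t + u)) ^+ 2.
    by rewrite !intrD (_ : u = 1 - 2 * t); [ring|lra].
  by apply: (segment_light K2E); rewrite ?intrD; lra.
have s0 := sqrtr_ge0 (1 + t ^+ 2).
have u0' : 0 <= beta * Num.sqrt (1 + u ^+ 2) by rewrite mulr_ge0 ?sqrtr_ge0.
have := polyline_cons (polyline_cons (polyline_cons ih s0 H1) u0' H2) s0 H3.
set L' := (X in polyline _ _ X -> _); set L := (X in _ -> polyline _ _ X).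
by have -> : L' = L by rewrite /L /L' -[n.+1%:R]natr1; ring.
Qed.

End Steps.

(** * The constants [Lambda3] and [beta0c] *)

Section SnellConstants.
Import numFieldNormedType.Exports.
Variable R : realType.
Implicit Types beta A B s t u : R.

(* [t] and [u] are the slopes of an S_3-path in the light and dark squares,
   [s] its Snell invariant, [A] and [B] the horizontal slownesses. *)
Record critical beta A B s t u : Prop := Critical {
  crit_A0 : 0 < A; crit_B0 : 0 < B; crit_s0 : 0 < s;
  crit_A : A ^+ 2 + s ^+ 2 = 1; crit_B : B ^+ 2 + s ^+ 2 = beta ^+ 2;
  crit_t : s = t * A; crit_u : s = u * B; crit_tu : 2 * t + u = 1 }.

Lemma critical_t0 beta A B s t u : critical beta A B s t u -> 0 < t.
Proof. by case=> A0 _ s0 _ _ sA _ _; move: s0; rewrite sA pmulr_lgt0. Qed.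

Lemma critical_u0 beta A B s t u : critical beta A B s t u -> 0 < u.
Proof. by case=> _ B0 s0 _ _ _ sB _; move: s0; rewrite sB pmulr_lgt0. Qed.

(** Optical length of the polygon that crosses a light, a dark and a light square of one strip,
    climbing [t], [u] and [t]. *)
Definition path_cost beta t u : R := 2 * Num.sqrt (1 + t ^+ 2) + beta * Num.sqrt (1 + u ^+ 2).

(** From [s = t * A] and [A ^ 2 + s ^ 2 = 1] the length of a light leg is [1 / A = A + s * t];
    likewise the dark leg costs [B + s * u]. The vertical contributions add up to
    [s * (2 * t + u) = s]. *)
Lemma critical_cost beta A B s t u : 0 <= beta -> critical beta A B s t u ->
  path_cost beta t u = 2 * A + B + s.
Proof.
move=> b0 cr; have t0 := critical_t0 cr; have u0 := critical_u0 cr.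
case: cr => A0 B0 s0 As Bs sA sB tu.
have E1 : Num.sqrt (1 + t ^+ 2) = A + s * t.
  have -> : 1 + t ^+ 2 = (A + s * t) ^+ 2.
    have -> : (A + s * t) ^+ 2 = (A ^+ 2 + (t * A) ^+ 2) * (1 + t ^+ 2) by rewrite sA; ring.
    by rewrite -sA As mul1r.
  by rewrite sqrtr_sqr ger0_norm// addr_ge0 ?mulr_ge0// ltW.
have E2 : beta * Num.sqrt (1 + u ^+ 2) = B + s * u.
  rewrite -{1}[beta]ger0_norm// -sqrtr_sqr -sqrtrM ?sqr_ge0//.
  have -> : beta ^+ 2 * (1 + u ^+ 2) = (B + s * u) ^+ 2.
    have -> : (B + s * u) ^+ 2 = (B ^+ 2 + (u * B) ^+ 2) * (1 + u ^+ 2) by rewrite sB; ring.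
    by rewrite -sB Bs.
  by rewrite sqrtr_sqr ger0_norm// addr_ge0 ?mulr_ge0// ltW.
rewrite /path_cost E1 E2 (_ : 2 * A + B + s = 2 * A + B + s * (2 * t + u)); first by ring.
by rewrite tu mulr1.
Qed.

(** Cauchy-Schwarz against the vectors [(A, s)], [(B, s)], of norms 1 and [beta]. Their common
    vertical component makes the sum depend on the total climb alone. *)
Lemma critical_min beta A B s t u t' u' : 0 <= beta -> critical beta A B s t u ->
  2 * t' + u' = 1 -> 2 * A + B + s <= path_cost beta t' u'.
Proof.
move=> b0 [A0 B0 s0 As Bs _ _ _] tu'.
have H1 : A * 1 + s * t' <= 1 * Num.sqrt (1 ^+ 2 + t' ^+ 2).
  by apply: le_trans (ler_norm _) _; apply: cauchy_schwarz2; rewrite ?As ?expr1n.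
have H2 : B * 1 + s * u' <= beta * Num.sqrt (1 ^+ 2 + u' ^+ 2).
  by apply: le_trans (ler_norm _) _; apply: cauchy_schwarz2; rewrite ?Bs.
move: H1 H2; rewrite /path_cost !expr1n !mulr1 mul1r => H1 H2.
have : s = s * (2 * t' + u') by rewrite tu' mulr1.
lra.
Qed.

Lemma critical_of_slopes beta t u : 0 < beta -> 0 < t -> 0 < u -> 2 * t + u = 1 ->
  t * Num.sqrt (1 + u ^+ 2) = beta * u * Num.sqrt (1 + t ^+ 2) ->
  critical beta (Num.sqrt (1 + t ^+ 2))^-1 (beta / Num.sqrt (1 + u ^+ 2))
    (t / Num.sqrt (1 + t ^+ 2)) t u.
Proof.
move=> b0 t0 u0 tu E.
have T0 : 0 < 1 + t ^+ 2 by rewrite ltr_wpDr// sqr_ge0.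
have U0 : 0 < 1 + u ^+ 2 by rewrite ltr_wpDr// sqr_ge0.
have ST : Num.sqrt (1 + t ^+ 2) ^+ 2 = 1 + t ^+ 2 by rewrite sqr_sqrtr// ltW.
have SU : Num.sqrt (1 + u ^+ 2) ^+ 2 = 1 + u ^+ 2 by rewrite sqr_sqrtr// ltW.
have T0' : 0 < Num.sqrt (1 + t ^+ 2) by rewrite sqrtr_gt0.
have U0' : 0 < Num.sqrt (1 + u ^+ 2) by rewrite sqrtr_gt0.
have E' : t / Num.sqrt (1 + t ^+ 2) = u * (beta / Num.sqrt (1 + u ^+ 2)).
  apply/eqP; rewrite mulrA eqr_div ?lt0r_neq0//; apply/eqP; rewrite E; ring.
split => //.
- by rewrite invr_gt0.
- by rewrite divr_gt0.
- by rewrite divr_gt0.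
- by rewrite !exprMn !exprVn ST; field; exact: lt0r_neq0.
- by rewrite E' !exprMn !exprVn SU; field; exact: lt0r_neq0.
Qed.

(** Snell's law as an intermediate value problem in [t]: the difference of its two sides is [- beta]
    at [t = 0] and [1 / 2] at [t = 1 / 2], where the dark leg is horizontal. *)
Lemma slopes_exist beta : 1 < beta -> exists t u, [/\ 0 < t, 0 < u, 2 * t + u = 1 &
  t * Num.sqrt (1 + u ^+ 2) = beta * u * Num.sqrt (1 + t ^+ 2)].
Proof.
move=> b1.
pose G t := t * Num.sqrt (1 + (1 - 2 * t) ^+ 2) - beta * (1 - 2 * t) * Num.sqrt (1 + t ^+ 2).
have csq (f : R -> R) : continuous f -> continuous (fun t => Num.sqrt (1 + f t ^+ 2)).
  move=> cf t; apply: (continuous_comp (f := fun t => 1 + f t ^+ 2)); last exact: sqrt_continuous.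
  by apply: cvgD; [exact: cvg_cst|apply: (cvgM (cf t) (cf t))].
have clin : continuous (fun t : R => 1 - 2 * t).
  by move=> t; apply: cvgB; [exact: cvg_cst|apply: cvgM; [exact: cvg_cst|exact: cvg_id]].
have cG : continuous G.
  move=> t; apply: cvgB; apply: cvgM.
  - exact: cvg_id.
  - exact: (csq _ clin t).
  - by apply: cvgM; [exact: cvg_cst|exact: clin].
  - exact: (csq _ (fun z => cvg_id) t).
have half0 : (0 : R) <= 1 / 2 by lra.
have G0 : G 0 = - beta.
  by rewrite /G mul0r mulr0 subr0 expr0n addr0 sqrtr1 !mulr1 sub0r.
have G1 : G (1 / 2) = 1 / 2.
  by rewrite /G (_ : 1 - 2 * (1 / 2) = 0) ?expr0n ?addr0 ?sqrtr1 ?mulr0 ?mul0r ?subr0 ?mulr1//; lra.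
have [|t] := @IVT R G 0 (1 / 2) 0 half0 (continuous_subspaceT cG).
  by rewrite G0 G1 ge_min le_max; apply/andP; split; apply/orP; [left|right]; lra.
rewrite in_itv/= => /andP[t0 t1] Gt.
have tn0 : t != 0 by apply/eqP => tE; move: Gt; rewrite tE G0; lra.
have tn1 : t != 1 / 2 by apply/eqP => tE; move: Gt; rewrite tE G1; lra.
exists t, (1 - 2 * t); split.
- by rewrite lt_neqAle eq_sym tn0.
- have : t < 1 / 2 by rewrite lt_neqAle tn1.
  lra.
- ring.
- by move: Gt => /eqP; rewrite /G subr_eq0 => /eqP.
Qed.

Lemma critical_solves beta A B s t u : 0 <= beta -> critical beta A B s t u ->
  0 < s < 1 /\ 2 * s / Num.sqrt (1 - s ^+ 2) + s / Num.sqrt (beta ^+ 2 - s ^+ 2) = 1.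
Proof.
move=> b0 [A0 B0 s0 As Bs sA sB tu].
have -> : Num.sqrt (1 - s ^+ 2) = A by rewrite -As addrK sqrtr_sqr gtr0_norm.
have -> : Num.sqrt (beta ^+ 2 - s ^+ 2) = B by rewrite -Bs addrK sqrtr_sqr gtr0_norm.
split; first by rewrite s0/=; nra.
by rewrite {1}sA sB mulrA !mulfK ?gt_eqF.
Qed.

Lemma solves_critical beta s : 1 < beta -> 0 < s < 1 ->
  2 * s / Num.sqrt (1 - s ^+ 2) + s / Num.sqrt (beta ^+ 2 - s ^+ 2) = 1 ->
  critical beta (Num.sqrt (1 - s ^+ 2)) (Num.sqrt (beta ^+ 2 - s ^+ 2)) s
    (s / Num.sqrt (1 - s ^+ 2)) (s / Num.sqrt (beta ^+ 2 - s ^+ 2)).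
Proof.
move=> b1 /andP[s0 s1] E.
have A0 : 0 < 1 - s ^+ 2 by nra.
have B0 : 0 < beta ^+ 2 - s ^+ 2 by nra.
have A0' : 0 < Num.sqrt (1 - s ^+ 2) by rewrite sqrtr_gt0.
have B0' : 0 < Num.sqrt (beta ^+ 2 - s ^+ 2) by rewrite sqrtr_gt0.
split => //.
- by rewrite sqr_sqrtr ?subrK// ltW.
- by rewrite sqr_sqrtr ?subrK// ltW.
- by rewrite divfK// gt_eqF.
- by rewrite divfK// gt_eqF.
- by rewrite mulrA.
Qed.

(** Existence of a root makes [xget] return a solution of Snell's equation instead of the default 0;
    the defining formula is then rearranged with [A ^ 2 + s ^ 2 = 1] and
    [B ^ 2 + s ^ 2 = beta ^ 2]. *)
Lemma Lambda3_critical beta : 1 < beta -> exists A B s t u,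
  critical beta A B s t u /\ Lambda3 beta = 2 * A + B + s.
Proof.
move=> b1; have b0 : 0 < beta by lra.
have [t' [u' [t0 u0 tu E]]] := slopes_exist b1.
have [s01 sE] := critical_solves (ltW b0) (critical_of_slopes b0 t0 u0 tu E).
have [S01 SE] : 0 < sigma3 beta < 1 /\ 2 * sigma3 beta / Num.sqrt (1 - sigma3 beta ^+ 2) +
    sigma3 beta / Num.sqrt (beta ^+ 2 - sigma3 beta ^+ 2) = 1.
  by apply: (@xgetPex _ 0 [set s | 0 < s < 1 /\ _]); eexists; split; [exact: s01|exact: sE].
have cr := solves_critical b1 S01 SE.
do 5 eexists; split; first exact: cr.
rewrite /Lambda3; set s := sigma3 beta in cr *.
set A := Num.sqrt (1 - s ^+ 2) in cr *; set B := Num.sqrt (beta ^+ 2 - s ^+ 2) in cr *.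
case: cr => A0 B0 s0 As Bs sA sB tu'.
have -> : 2 / A = 2 * A + s * (2 * (s / A)).
  rewrite -{1}As; field; exact: lt0r_neq0.
have -> : beta ^+ 2 / B = B + s * (s / B) by rewrite -Bs; field; exact: lt0r_neq0.
rewrite (_ : 2 * A + B + s = 2 * A + B + s * (2 * (s / A) + s / B)); first by ring.
by rewrite tu' mulr1.
Qed.

Lemma Lambda3_le beta t u : 1 < beta -> 2 * t + u = 1 -> Lambda3 beta <= path_cost beta t u.
Proof.
move=> b1 tu; have [A [B [s [t' [u' [cr ->]]]]]] := Lambda3_critical b1.
by apply: critical_min cr tu; lra.
Qed.

(** The optimal path for [beta'] competes for [beta], and costs no more there. *)
Lemma Lambda3_mono beta beta' : 1 < beta -> beta <= beta' -> Lambda3 beta <= Lambda3 beta'.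
Proof.
move=> b1 bb'; have b'1 : 1 < beta' by lra.
have [A [B [s [t [u [cr ->]]]]]] := Lambda3_critical b'1.
rewrite -(critical_cost _ cr); last lra.
apply: le_trans (Lambda3_le b1 (crit_tu cr)) _.
by rewrite /path_cost lerD2l ler_wpM2r// sqrtr_ge0.
Qed.

Lemma sigma_hat2 beta : sigma_hat 2 beta = sigma3 beta.
Proof.
rewrite /sigma_hat /sigma3; congr (xget _ _); apply/funext => s.
have q2 : qn (2 : R) = 1.
  rewrite /qn (_ : Num.floor (2 : R) = 2) /=; first by lra.
  by apply: floor_def; rewrite intrD; apply/andP; split; lra.
by rewrite /mkset /pn q2 mul1r (_ : 2 + 1 - 1 = 2)//; ring.
Qed.

Lemma lnorm2 beta : lnorm 2 beta = Lambda3 beta - 2 - Num.sqrt 2.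
Proof.
have q2 : qn (2 : R) = 1.
  rewrite /qn (_ : Num.floor (2 : R) = 2) /=; first by lra.
  by apply: floor_def; rewrite intrD; apply/andP; split; lra.
by rewrite /lnorm sigma_hat2 /Lambda3 /pn q2 mulr1 (_ : 2 + 1 - 1 = 2)//; ring.
Qed.

Lemma sqrt2_bounds : 1414 / 1000 < Num.sqrt (2 : R) < 1415 / 1000.
Proof.
have s0 := sqrtr_ge0 (2 : R); have s2 : Num.sqrt 2 ^+ 2 = 2 :> R by rewrite sqr_sqrtr.
by apply/andP; split; nra.
Qed.

(** The unknown [beta] is eliminated: Snell's law expresses it through the slope [t], and
    [Lambda3 = 2 + sqrt 2] becomes one equation in [t], solved by the intermediate value theorem. *)
Lemma beta0c_spec : 1 < beta0c R < Num.sqrt 2 /\ Lambda3 (beta0c R) = 2 + Num.sqrt 2.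
Proof.
have /andP[s1 s2] := sqrt2_bounds.
suff [b [b1 b2 bE]] : exists b : R, [/\ 1 < b, b < Num.sqrt 2 & Lambda3 b = 2 + Num.sqrt 2].
  have [] : 1 < beta0c R < Num.sqrt 2 /\ lnorm 2 (beta0c R) = 0.
    apply: (@xgetPex _ 0 [set b | 1 < b < Num.sqrt 2 /\ lnorm 2 b = 0]).
    by exists b; split; [rewrite b1|rewrite lnorm2 bE; lra].
  by move=> H; rewrite lnorm2 => E; split=> //; lra.
(* With [u = 1 - 2 * t] this is [path_cost b t u - (2 + sqrt 2)] multiplied by
   [u * sqrt (1 + t ^ 2)], where [b] is the constant given by Snell's law. The slope [t = 1 / 3]
   corresponds to [b = 1] and a straight path of length [sqrt 10 < 2 + sqrt 2]; at [t = 1 / 2] the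
   factor [u] vanishes. *)
pose H t := 2 * (1 + t ^+ 2) * (1 - 2 * t) + t * (1 + (1 - 2 * t) ^+ 2)
  - (2 + Num.sqrt 2) * (1 - 2 * t) * Num.sqrt (1 + t ^+ 2).
have clin : continuous (fun t : R => 1 - 2 * t).
  by move=> t; apply: cvgB; [exact: cvg_cst|apply: cvgM; [exact: cvg_cst|exact: cvg_id]].
have csq (f : R -> R) : continuous f -> continuous (fun t => 1 + f t ^+ 2).
  by move=> cf t; apply: cvgD; [exact: cvg_cst|apply: (cvgM (cf t) (cf t))].
have cid : continuous (fun t : R => t) by move=> t; exact: cvg_id.
have cH : continuous H.
  move=> t; apply: cvgB; [apply: cvgD; apply: cvgM|apply: cvgM].
  - by apply: cvgM; [exact: cvg_cst|exact: (csq _ cid t)].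
  - exact: clin.
  - exact: cvg_id.
  - exact: (csq _ clin t).
  - by apply: cvgM; [exact: cvg_cst|exact: clin].
  - apply: (continuous_comp (f := fun t => 1 + t ^+ 2)); first exact: (csq _ cid t).
    exact: sqrt_continuous.
have H0 : H (1 / 3) < 0.
  have S : 1 <= Num.sqrt (1 + (1 / 3) ^+ 2 : R).
    by rewrite -{1}sqrtr1 ler_sqrt//; nra.
  by rewrite /H; nra.
have H1 : H (1 / 2) = 1 / 2.
  by rewrite /H (_ : 1 - 2 * (1 / 2) = 0) ?expr0n ?mulr0 ?mul0r ?subr0 ?addr0 ?add0r ?mulr1//; lra.
have le32 : (1 / 3 : R) <= 1 / 2 by lra.
have [|t] := @IVT R H (1 / 3) (1 / 2) 0 le32 (continuous_subspaceT cH).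
  by rewrite H1 ge_min le_max; apply/andP; split; apply/orP; [left|right]; lra.
rewrite in_itv/= => /andP[t0 t1] Ht.
have tn0 : t != 1 / 3 by apply/eqP => tE; move: Ht; rewrite tE => E; move: H0; rewrite E ltxx.
have tn1 : t != 1 / 2 by apply/eqP => tE; move: Ht; rewrite tE H1; lra.
have {tn0}t0 : 1 / 3 < t by rewrite lt_neqAle eq_sym tn0.
have {tn1}t1 : t < 1 / 2 by rewrite lt_neqAle tn1.
have u0 : 0 < 1 - 2 * t by lra.
have u1 : 1 - 2 * t < t by lra.
have tu : 2 * t + (1 - 2 * t) = 1 by ring.
move: Ht; rewrite /H; set u := 1 - 2 * t in u0 u1 tu * => Ht.
have tp : 0 < t by lra.
have T0 : 0 < 1 + t ^+ 2 by rewrite ltr_wpDr// sqr_ge0.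
have U0 : 0 < 1 + u ^+ 2 by rewrite ltr_wpDr// sqr_ge0.
have T1 : 0 < Num.sqrt (1 + t ^+ 2) by rewrite sqrtr_gt0.
have U1 : 0 < Num.sqrt (1 + u ^+ 2) by rewrite sqrtr_gt0.
have T2 : Num.sqrt (1 + t ^+ 2) ^+ 2 = 1 + t ^+ 2 by rewrite sqr_sqrtr// ltW.
have U2 : Num.sqrt (1 + u ^+ 2) ^+ 2 = 1 + u ^+ 2 by rewrite sqr_sqrtr// ltW.
have T3 : 1 < Num.sqrt (1 + t ^+ 2) by nra.
have U3 : 1 < Num.sqrt (1 + u ^+ 2) by nra.
have un0 := lt0r_neq0 u0; have Tn0 := lt0r_neq0 T1; have Un0 := lt0r_neq0 U1.
pose b := t * Num.sqrt (1 + u ^+ 2) / (u * Num.sqrt (1 + t ^+ 2)).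
have b0 : 0 < b by rewrite divr_gt0// mulr_gt0.
have bE : t * Num.sqrt (1 + u ^+ 2) = b * u * Num.sqrt (1 + t ^+ 2).
  by rewrite /b; field; rewrite ?un0 ?Tn0.
have b1 : 1 < b.
  rewrite /b ltr_pdivlMr ?mulr_gt0// mul1r -(@ltr_pXn2r _ 2)// ?nnegrE ?mulr_ge0 ?ltW//.
  by rewrite !exprMn T2 U2; nra.
have cost : path_cost b t u = 2 + Num.sqrt 2.
  apply: (mulIf (lt0r_neq0 (mulr_gt0 u0 T1))); rewrite /path_cost.
  have -> : (2 * Num.sqrt (1 + t ^+ 2) + b * Num.sqrt (1 + u ^+ 2)) * (u * Num.sqrt (1 + t ^+ 2)) =
    2 * Num.sqrt (1 + t ^+ 2) ^+ 2 * u + (b * u * Num.sqrt (1 + t ^+ 2)) * Num.sqrt (1 + u ^+ 2) by ring.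
  rewrite -bE T2 (_ : t * Num.sqrt (1 + u ^+ 2) * Num.sqrt (1 + u ^+ 2) = t * (1 + u ^+ 2)); first by lra.
  by rewrite -mulrA -expr2 U2.
have cr := critical_of_slopes b0 tp u0 tu bE.
exists b; split=> //.
(* Both square roots exceed 1, so a total of [2 + sqrt 2] leaves [b < sqrt 2]. *)
- move: cost; rewrite /path_cost => cost; nra.
- apply/eqP; rewrite eq_le -{1}cost Lambda3_le//=.
  rewrite -cost (critical_cost (ltW b0) cr).
  have [A [B [s [t' [u' [cr' E]]]]]] := Lambda3_critical b1.
  by rewrite E -(critical_cost (ltW b0) cr'); apply: critical_min cr (crit_tu cr'); exact: ltW.
Qed.

End SnellConstants.

(** * Admissible parameters in the two regimes *)

Section Admissibility.
Variable R : realType.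
Implicit Types beta A B s t u : R.

Lemma sqr_le (a b : R) : 0 <= b -> a ^+ 2 <= b ^+ 2 -> a <= b.
Proof.
move=> b0; have [//|ba] := leP a b; rewrite ler_pXn2r ?nnegrE//; last lra.
by move=> /(lt_le_trans ba); rewrite ltxx.
Qed.

Lemma unit_sum_le (a b : R) : a ^+ 2 + b ^+ 2 = 1 -> a + b <= Num.sqrt 2.
Proof.
move=> ab; apply: sqr_le; rewrite ?sqrtr_ge0// sqr_sqrtr//.
by have := sqr_ge0 (a - b); rewrite sqrrB sqrrD; lra.
Qed.

(** The decimals follow from [1 / 3 <= t < 1 / 2], which places [A ^ 2 = 1 / (1 + t ^ 2)] between
    4/5 and 9/10, and from [beta ^ 2 >= 3 / 2]. They are fine enough for the delicate inequalities
    [A + B >= 2] and [B + s >= sqrt 2]. *)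
Record critical_bounds beta A B s : Prop := CriticalBounds {
  cb_A : 89 / 100 <= A; cb_A1 : A <= 1; cb_B : 114 / 100 <= B;
  cb_s : 316 / 1000 <= s; cb_s1 : s <= 448 / 1000 }.

Lemma critical_boundsP beta A B s t u : 1 < beta -> 3 / 2 <= beta ^+ 2 ->
  critical beta A B s t u -> critical_bounds beta A B s.
Proof.
move=> b1 b2 cr; have t0 := critical_t0 cr; have u0 := critical_u0 cr.
case: cr => A0 B0 s0 As Bs sA sB tu.
have AB : A <= B by apply: sqr_le; nra.
have ut : u <= t by rewrite -(ler_pM2r B0) -sB sA ler_wpM2l// ltW.
have t3 : 1 / 3 <= t by lra.
have t2 : t < 1 / 2 by lra.
have A1 : A ^+ 2 * (1 + t ^+ 2) = 1.
  have -> : A ^+ 2 * (1 + t ^+ 2) = A ^+ 2 + (t * A) ^+ 2 by ring.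
  by rewrite -sA.
have A45 : 4 / 5 <= A ^+ 2 by nra.
have A910 : A ^+ 2 <= 9 / 10 by nra.
by split; apply: sqr_le; lra.
Qed.

(** The straight path [t = u = 1 / 3] costs [(2 + beta) * sqrt 10 / 3], which is below 3.41 when
    [beta ^ 2 < 3 / 2]. This supplies the bound on [beta] in the regime above [beta0c]. *)
Lemma beta2_of_Lambda3 beta : 1 < beta -> 2 + Num.sqrt 2 <= Lambda3 beta -> 3 / 2 <= beta ^+ 2.
Proof.
move=> b1 L; rewrite leNgt; apply/negP => b2.
have tu : 2 * (1 / 3) + 1 / 3 = 1 :> R by lra.
have := le_trans L (Lambda3_le b1 tu); rewrite /path_cost.
have /andP[s1 s2] := sqrt2_bounds R.
have S0 := sqrtr_ge0 (1 + (1 / 3) ^+ 2 : R).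
have S : Num.sqrt (1 + (1 / 3) ^+ 2) ^+ 2 = 1 + (1 / 3) ^+ 2 :> R.
  by rewrite sqr_sqrtr// addr_ge0// sqr_ge0.
have S1 : Num.sqrt (1 + (1 / 3) ^+ 2) <= 1055 / 1000 :> R by apply: sqr_le; lra.
have b3 : beta <= 1225 / 1000 by apply: sqr_le; lra.
set S' := Num.sqrt _ in S0 S S1 *.
have : beta * S' <= 1225 / 1000 * (1055 / 1000) by apply: ler_pM => //; lra.
by lra.
Qed.

(** Horizontal steps are tight. The minimum serves two cases: its first entry makes diagonals tight,
    its second S_3-paths. The bound [A + s <= 1 + c] amounts to [A + s <= sqrt 2] for one entry and
    to [A + B >= 2] for the other. *)
Lemma admissible_horizontal beta A B s t u : 1 < beta -> 3 / 2 <= beta ^+ 2 ->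
  critical beta A B s t u -> forall c, c = Num.min (Num.sqrt 2 - 1) (2 * A + B + s - 3) ->
  admissible beta (Num.sqrt 2 / 2) A B s 1 c.
Proof.
move=> b1 b2 cr c cE; have [? ? ? ? ?] := critical_boundsP b1 b2 cr.
case: cr => A0 B0 s0 As Bs _ _ _.
have /andP[s1 s2] := sqrt2_bounds R.
have r2 : 2 * (Num.sqrt 2 / 2) ^+ 2 = 1 :> R by rewrite expr_div_n sqr_sqrtr//; lra.
have As2 := unit_sum_le As.
have c1 : c <= Num.sqrt 2 - 1 by rewrite cE ge_min lexx.
have c2 : c <= 2 * A + B + s - 3 by rewrite cE ge_min lexx orbT.
have c3 : A + s - 1 <= c.
  by rewrite cE le_min; clear cE As Bs b2 r2; apply/andP; split; lra.
by split=> //; clear As Bs b2 r2; lra.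
Qed.

(** The parameters solve [del + c = sqrt 2] and [3 * del + c = Lambda3]. Then [del <= 1] is the
    hypothesis on [2 * A + B + s], and [A <= del] amounts to [sqrt 2 <= B + s]. *)
Lemma admissible_diagonal beta A B s t u : 1 < beta -> 3 / 2 <= beta ^+ 2 ->
  critical beta A B s t u -> 2 * A + B + s <= 2 + Num.sqrt 2 ->
  admissible beta (Num.sqrt 2 / 2) A B s ((2 * A + B + s - Num.sqrt 2) / 2)
    ((3 * Num.sqrt 2 - (2 * A + B + s)) / 2).
Proof.
move=> b1 b2 cr L; have [? ? ? ? ?] := critical_boundsP b1 b2 cr.
case: cr => A0 B0 s0 As Bs _ _ _.
have /andP[s1 s2] := sqrt2_bounds R.
have r2 : 2 * (Num.sqrt 2 / 2) ^+ 2 = 1 :> R by rewrite expr_div_n sqr_sqrtr//; lra.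
have As2 := unit_sum_le As.
by split=> //; clear As Bs b2 r2; lra.
Qed.

End Admissibility.

(** * Optical length of geodesics from both sides *)

Section Main.
Variable R : realType.
Implicit Types beta x y : R.

Lemma geodesic_le beta x y l (u1 u2 : R -> R) : 1 <= beta ->
  geodesic beta 0 0 x y u1 u2 -> polyline beta x y l ->
  (optical_length beta u1 u2 <= l%:E)%E.
Proof.
move=> b1 [_ _ _ H] /(polyline_curve b1)[v1 [v2 [ac [v10 v20] [v11 v21] vl]]].
exact: le_trans (H _ _ ac v10 v20 v11 v21) vl.
Qed.

Lemma geodesic_ge beta r A B s del c x (j : int) (u1 u2 : R -> R) :
  admissible beta r A B s del c -> geodesic beta 0 0 x j%:~R u1 u2 ->
  ((del * x + c * j%:~R)%:E <= optical_length beta u1 u2)%E.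
Proof.
move=> adm [ac [u10 u20] [u11 u21] _].
have := calibration_le (adm_beta adm) (calibration_potential adm) ac.
rewrite u10 u20 u11 u21 !(potential_horizontal adm) -[0]/(0%:~R : R).
by rewrite (potential_horizontal adm) mulr0 add0r mulr0 subr0.
Qed.

Lemma light_vertex_nat x y : light_vertex x y -> 0 <= y -> y <= x ->
  exists n j : nat, x = (2 * n%:Z + j%:Z)%:~R /\ y = (j%:Z)%:~R.
Proof.
move=> [n [j [-> ->]]]; rewrite ler0z ler_int => j0 nj.
have n0 : 0 <= n by lia.
case: n n0 {nj} => // n _; case: j j0 => // j _; by exists n, j; split=> //.
Qed.

End Main.

Unset Implicit Arguments.

Theorem theorem5p5 (R : realType) (beta x y : R) (u1 u2 : R -> R) :
  1 < beta ->
  light_vertex x y -> 0 <= y -> y <= x ->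
  geodesic beta 0 0 x y u1 u2 ->
  (beta0c R <= beta ->
     optical_length beta u1 u2 = (x + (Num.sqrt 2 - 1) * y)%:E) /\
  (Num.sqrt (3 / 2) <= beta -> beta <= beta0c R ->
     (y <= x / 3 ->
        optical_length beta u1 u2 = (x + (Lambda3 beta - 3) * y)%:E) /\
     (x / 3 <= y ->
        optical_length beta u1 u2 =
          ((Lambda3 beta - Num.sqrt 2) / 2 * x
           + (3 * Num.sqrt 2 - Lambda3 beta) / 2 * y)%:E)).
Proof.
move=> b1 lv y0 yx geo; have [n [j [xE yE]]] := light_vertex_nat lv y0 yx.
have b1' : 1 <= beta by exact: ltW.
have b0 : 0 <= beta by lra.
have [/andP[c1 c2] LcE] := beta0c_spec R.
have [A [B [s [t [u [cr LE]]]]]] := Lambda3_critical b1.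
have P0 : polyline beta (0%:~R) (0%:~R) 0 by exact: polyline_nil.
have Z0 : 0 = 0 + 2 * 0 :> int by [].
have S3 k : polyline beta (3 * k%:Z)%:~R (k%:Z)%:~R (Lambda3 beta * k%:R).
  have := polyline_S3 k b0 (critical_t0 cr) (critical_u0 cr) (crit_tu cr) Z0 P0.
  by rewrite -/(path_cost _ _ _) (critical_cost b0 cr) -LE !add0r.
rewrite {}xE {}yE in geo *.
split=> [bc|b2 bc].
  have L : 2 + Num.sqrt 2 <= Lambda3 beta by rewrite -LcE; exact: Lambda3_mono.
  have b2 := beta2_of_Lambda3 b1 L.
  apply/eqP; rewrite eq_le; apply/andP; split.
    (* The target is [(2 * n + j, j)]: [j] diagonals, then [n] horizontal steps of length 2. *)
    have := polyline_horizontal n (polyline_diagonal j Z0 P0).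
    rewrite !add0r (_ : _ + 2 * n%:R = (2 * n%:Z + j%:Z)%:~R) => [P|]; last first.
      by rewrite intrD intrM -pmulrn addrC.
    apply: le_trans (geodesic_le b1' geo P) _.
    by rewrite lee_fin intrD intrM -!pmulrn; lra.
  have adm := admissible_horizontal b1 b2 cr (erefl _).
  apply: le_trans (geodesic_ge adm geo); rewrite lee_fin mul1r lerD2l// ler_wpM2r//.
  by rewrite le_min lexx/= -LE; lra.
have b2' : 3 / 2 <= beta ^+ 2.
  rewrite -[leLHS]sqr_sqrtr; last lra.
  by rewrite ler_pXn2r ?nnegrE ?sqrtr_ge0.
have L : Lambda3 beta <= 2 + Num.sqrt 2 by rewrite -LcE; exact: Lambda3_mono.
split=> [y3|y3]; apply/eqP; rewrite eq_le; apply/andP; split.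
(* [j] S_3-paths lead to [(3 * j, j)], and [n - j] horizontal steps of length 2 remain; [y <= x / 3]
   says exactly that [j <= n]. *)
- have jn : (j <= n)%N.
    by rewrite -(ler_nat R); move: y3; rewrite intrD intrM -!pmulrn; lra.
  have := polyline_horizontal (n - j) (S3 j).
  rewrite (_ : _ + 2 * (n - j)%:R = (2 * n%:Z + j%:Z)%:~R) => [P|]; last first.
    by rewrite intrD !intrM natrB// -!pmulrn; ring.
  apply: le_trans (geodesic_le b1' geo P) _.
  by rewrite lee_fin intrD intrM natrB// -!pmulrn; lra.
- have adm := admissible_horizontal b1 b2' cr (erefl _).
  apply: le_trans (geodesic_ge adm geo); rewrite lee_fin mul1r lerD2l// ler_wpM2r//.
  by rewrite le_min -LE lexx andbT; lra.
(* [n] S_3-paths lead to [(3 * n, n)], and [j - n] diagonals remain. *)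
- have nj : (n <= j)%N.
    by rewrite -(ler_nat R); move: y3; rewrite intrD intrM -!pmulrn; lra.
  have E : 3 * n%:Z = n%:Z + 2 * n%:Z by ring.
  have := polyline_diagonal (j - n) E (S3 n).
  have -> : 3 * n%:Z + (j - n)%:Z = 2 * n%:Z + j%:Z by lia.
  have -> : n%:Z + (j - n)%:Z = j%:Z by lia.
  move=> P; apply: le_trans (geodesic_le b1' geo P) _.
  by rewrite lee_fin intrD intrM natrB// -!pmulrn; lra.
- rewrite LE in L *; have adm := admissible_diagonal b1 b2' cr L.
  exact: geodesic_ge adm geo.
Qed.
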